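(* Let $(M,g)$ be an $n$-dimensional, $n\geq 3$, compact Riemannian manifold with positive sectional curvature, and let $f\in C^\infty(M)$. Then $\mathrm{div}(e^{-f}\mathrm{Riem})=0$ and $R+\Delta f=n\lambda$ for some $\lambda\in\mathbb{R}$, if and only if $(M,g,f)$ is a gradient Ricci soliton, i.e. $\mathrm{Ric}+\nabla^2 f=\lambda g$ for some $\lambda\in\mathbb{R}$.
   Context: Manifolds are smooth and without boundary. $\mathrm{Riem}$, with components $R_{ijkl}$, is the $(0,4)$ Riemann curvature tensor, $\mathrm{Ric}$ the Ricci tensor, $R$ the scalar curvature; $\mathrm{div}(e^{-f}\mathrm{Riem})_{jkl}=\nabla_i(e^{-f}R_{ijkl})$ (sum over $i$, orthonormal frame). *)

(* Defs.v *)
From HB Require Import structures.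
From mathcomp Require Import all_boot all_order all_algebra.
From mathcomp Require Import all_classical all_reals all_analysis.

Set Implicit Arguments.
Unset Strict Implicit.
Unset Printing Implicit Defensive.

Import Order.TTheory GRing.Theory Num.Theory.
Import numFieldNormedType.Exports.

Local Open Scope classical_set_scope.
Local Open Scope ring_scope.

(* Riemannian geometry by means of an atlas: geometric objects are given by
   their components in each chart, as functions on the image of the chart
   in 'rV[R]_n. Charts, their inverses and component functions are total
   functions; their values outside the chart domain (resp. the chart image,
   an open set) are never used. *)

Section SmoothFunctions.
Variables (R : realType) (n : nat).

Definition pderiv (i : 'I_n) (u : 'rV[R]_n -> R) : 'rV[R]_n -> R :=
  fun x => 'D_(delta_mx 0 i) u x.

Definition iter_pderiv (s : seq 'I_n) (u : 'rV[R]_n -> R) : 'rV[R]_n -> R :=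
  foldr pderiv u s.

(* C^oo on the open set U: partial derivatives of all orders exist and are
   continuous at every point of U. *)
Definition smooth_on (U : set 'rV[R]_n) (u : 'rV[R]_n -> R) : Prop :=
  forall (s : seq 'I_n) (x : 'rV[R]_n), U x ->
    {for x, continuous (iter_pderiv s u)} /\
    forall i : 'I_n, derivable (iter_pderiv s u) x (delta_mx 0 i).

Definition smooth_map_on (U : set 'rV[R]_n) (F : 'rV[R]_n -> 'rV[R]_n) : Prop :=
  forall a : 'I_n, smooth_on U (fun x => F x 0 a).

End SmoothFunctions.

(* Smooth n-manifold without boundary (not assumed connected). *)
Record smooth_manifold (R : realType) (n : nat) (M : topologicalType) := {
  chart_index : Type;
  chart_dom : chart_index -> set M;
  chart : chart_index -> M -> 'rV[R]_n;
  chart_inv : chart_index -> 'rV[R]_n -> M;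
  manifold_hausdorff : hausdorff_space M;
  manifold_second_countable : @second_countable M;
  chart_cover : forall p : M, exists c, chart_dom c p;
  chart_dom_open : forall c, open (chart_dom c);
  chart_image_open : forall c, open (chart c @` chart_dom c);
  chartK : forall c p, chart_dom c p -> chart_inv c (chart c p) = p;
  chart_continuous : forall c p, chart_dom c p -> {for p, continuous (chart c)};
  chart_inv_continuous : forall c x, (chart c @` chart_dom c) x ->
    {for x, continuous (chart_inv c)};
  transition_smooth : forall c d,
    smooth_map_on (chart c @` (chart_dom c `&` chart_dom d))
                  (chart d \o chart_inv c)
}.

Section ManifoldFunctions.
Variables (R : realType) (n : nat) (M : topologicalType).
Variable A : smooth_manifold R n M.

Definition chart_image (c : chart_index A) : set 'rV[R]_n :=
  chart c @` chart_dom c.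

Definition transition (c d : chart_index A) : 'rV[R]_n -> 'rV[R]_n :=
  chart d \o chart_inv c.

Definition in_chart (f : M -> R) (c : chart_index A) : 'rV[R]_n -> R :=
  f \o chart_inv c.

Definition smooth_function (f : M -> R) : Prop :=
  forall c : chart_index A, smooth_on (chart_image c) (in_chart f c).

End ManifoldFunctions.

(* [metric_mx c x i j] is g(d_i, d_j) at the point of coordinates x in the
   chart c. In [metric_transition], J := 'J (transition c d) x has entries
   J k a = d y^a / d x^k (row-vector convention). *)
Record riemannian_metric (R : realType) (n : nat) (M : topologicalType)
    (A : smooth_manifold R n M) := {
  metric_mx : chart_index A -> 'rV[R]_n -> 'M[R]_n;
  metric_smooth : forall c i j,
    smooth_on (chart_image c) (fun x => metric_mx c x i j);
  metric_sym : forall c x, chart_image c x ->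
    (metric_mx c x)^T = metric_mx c x;
  metric_posdef : forall c x (v : 'rV[R]_n), chart_image c x -> v != 0 ->
    0 < (v *m metric_mx c x *m v^T) 0 0;
  metric_transition : forall c d x,
    (chart c @` (chart_dom c `&` chart_dom d)) x ->
    metric_mx c x =
      'J (transition c d) x *m metric_mx d (transition c d x)
        *m ('J (transition c d) x)^T
}.

Section LocalGeometry.
Variables (R : realType) (n : nat) (g : 'rV[R]_n -> 'M[R]_n).
Implicit Types (i j k l m a b : 'I_n) (x u v : 'rV[R]_n).

Definition metric_inv x : 'M[R]_n := invmx (g x).

(* christoffel k i j = Gamma^k_{ij} *)
Definition christoffel k i j x : R :=
  2^-1 * \sum_m metric_inv x k m *
    (pderiv i (fun y => g y j m) x + pderiv j (fun y => g y i m) x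
     - pderiv m (fun y => g y i j) x).

(* riem13 i j k l = R^i_{jkl}, the d_i-component of R(d_k, d_l) d_j, where
   R(X, Y) = [nabla_X, nabla_Y] - nabla_[X, Y]. *)
Definition riem13 i j k l x : R :=
  pderiv k (christoffel i l j) x - pderiv l (christoffel i k j) x
  + \sum_m (christoffel i k m x * christoffel m l j x
            - christoffel i l m x * christoffel m k j x).

Definition riem i j k l x : R := \sum_m g x i m * riem13 m j k l x.

Definition ricci j l x : R := \sum_i \sum_k metric_inv x i k * riem i j k l x.

Definition scalar_curv x : R := \sum_j \sum_l metric_inv x j l * ricci j l x.

Definition metric_dot x u v : R := (u *m g x *m v^T) 0 0.

(* Sectional curvature of the plane spanned by u and v. *)
Definition sectional x u v : R :=
  (\sum_i \sum_j \sum_k \sum_l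
     riem i j k l x * u 0 i * v 0 j * u 0 k * v 0 l)
  / (metric_dot x u u * metric_dot x v v - metric_dot x u v ^+ 2).

Definition hess (f : 'rV[R]_n -> R) i j x : R :=
  pderiv i (pderiv j f) x - \sum_k christoffel k i j x * pderiv k f x.

Definition laplacian (f : 'rV[R]_n -> R) x : R :=
  \sum_i \sum_j metric_inv x i j * hess f i j x.

(* nabla4 T m i j k l = nabla_m T_{ijkl} for a (0,4)-tensor T *)
Definition nabla4 (T : 'I_n -> 'I_n -> 'I_n -> 'I_n -> 'rV[R]_n -> R)
    m i j k l x : R :=
  pderiv m (T i j k l) x
  - \sum_a (christoffel a m i x * T a j k l x
            + christoffel a m j x * T i a k l x
            + christoffel a m k x * T i j a l x
            + christoffel a m l x * T i j k a x).

(* Divergence in the first slot. The contraction g^{mi} nabla_m T_{ijkl} is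
   the sum of nabla_i T_{ijkl} over i in an orthonormal frame. *)
Definition div4 (T : 'I_n -> 'I_n -> 'I_n -> 'I_n -> 'rV[R]_n -> R)
    j k l x : R :=
  \sum_m \sum_i metric_inv x m i * nabla4 T m i j k l x.

Definition weighted_riem (f : 'rV[R]_n -> R) i j k l x : R :=
  expR (- f x) * riem i j k l x.

End LocalGeometry.

Section GlobalConditions.
Variables (R : realType) (n : nat) (M : topologicalType).
Variables (A : smooth_manifold R n M) (g : riemannian_metric A).

Definition positive_sectional_curvature : Prop :=
  forall (c : chart_index A) (x : 'rV[R]_n), chart_image c x ->
  forall u v : 'rV[R]_n, row_free (col_mx u v) ->
    0 < sectional (metric_mx g c) x u v.

Definition weighted_riem_div_free (f : M -> R) : Prop :=
  forall (c : chart_index A) (x : 'rV[R]_n), chart_image c x ->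
  forall j k l : 'I_n,
    div4 (metric_mx g c)
      (weighted_riem (metric_mx g c) (in_chart f c)) j k l x = 0.

(* R + Delta f = n lambda *)
Definition soliton_trace_equation (f : M -> R) (lambda : R) : Prop :=
  forall (c : chart_index A) (x : 'rV[R]_n), chart_image c x ->
    scalar_curv (metric_mx g c) x + laplacian (metric_mx g c) (in_chart f c) x
    = n%:R * lambda.

(* Ric + nabla^2 f = lambda g *)
Definition gradient_ricci_soliton (f : M -> R) (lambda : R) : Prop :=
  forall (c : chart_index A) (x : 'rV[R]_n), chart_image c x ->
  forall i j : 'I_n,
    ricci (metric_mx g c) i j x + hess (metric_mx g c) (in_chart f c) i j x
    = lambda * metric_mx g c x i j.

End GlobalConditions.

(* Main.v *)
From HB Require Import structures.
From mathcomp Require Import all_boot all_order all_algebra.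
From mathcomp Require Import all_classical all_reals all_analysis.
From mathcomp Require Import complex ring lra.
Require Import Defs.

(* Put T = Ric + Hess f. The contracted second Bianchi identity and the Ricci
   identity give div(e^-f Rm)_jkl = e^-f (nabla_k T_jl - nabla_l T_jk), so a
   gradient soliton is divergence free; conversely S = T - lambda g is a
   symmetric trace-free Codazzi tensor. For such an S, Simons' identity reads
     1/2 Delta |S|^2 = |nabla S|^2 + 1/2 sum_ab K_ab (s_a - s_b)^2
   in an orthonormal frame diagonalizing S, with K_ab the sectional
   curvatures. At a maximum of |S|^2 the left-hand side is nonpositive, so all
   eigenvalues s_a agree, and they vanish since S is trace free. The maximum of
   |S|^2 is thus zero.

   The tensor identities are algebraic: they hold over any commutative ring
   containing 1/2 with commuting derivations d_i, and are used in the ring of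
   smooth functions on the image of a chart. *)

Set Implicit Arguments.
Unset Strict Implicit.
Unset Printing Implicit Defensive.

Import Order.TTheory GRing.Theory Num.Theory.
Import numFieldNormedType.Exports.

Local Open Scope classical_set_scope.
Local Open Scope ring_scope.

(** * Levi-Civita connection over a differential ring *)

(** Two obstacles shape the proof. The geometry is given chart by chart, but a maximum exists only
    on the compact manifold. So |S|^2 must be shown to be independent of the chart, which requires
    the transformation laws of Ric and Hess f. And the eigenvectors of S need not depend smoothly on
    the point. So Simons' identity is proved in coordinates, with |S|^2 written as the trace of the
    square of S g^-1, and an eigenframe is chosen only at the maximum point. Christoffel symbols are
    handled as matrices [C k], covariant differentiation of covectors being d_k - C_k. The Ricci
    identity is then a commutator, the second Bianchi identity is the Jacobi identity, and a change
    of chart is a gauge transformation. The weight e^-f is what brings in f: differentiating it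
    contracts Rm with -df, and the same term appears when the covariant derivatives of df are
    commuted. *)

Definition derivation (A : comNzRingType) (d : A -> A) : Prop :=
  (forall a b, d (a + b) = d a + d b) /\
  (forall a b, d (a * b) = d a * b + a * d b).

Section Derivation.
Variables (A : comNzRingType) (d : A -> A).
Hypothesis d_der : derivation d.

Lemma derD a b : d (a + b) = d a + d b. Proof. by case: d_der. Qed.
Lemma derM a b : d (a * b) = d a * b + a * d b. Proof. by case: d_der. Qed.

Lemma der0 : d 0 = 0.
Proof. by apply: (addrI (d 0)); rewrite -derD !addr0. Qed.

Lemma derN a : d (- a) = - d a.
Proof. by apply: (addrI (d a)); rewrite -derD !subrr der0. Qed.

Lemma der1 : d 1 = 0.
Proof. by apply: (addrI (d 1)); rewrite addr0 -{3}(mulr1 1) derM mulr1 mul1r. Qed.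

Lemma der_sum I (r : seq I) (P : pred I) F :
  d (\sum_(i <- r | P i) F i) = \sum_(i <- r | P i) d (F i).
Proof. exact: (big_morph d derD der0). Qed.

Lemma map_derD m n (M N : 'M[A]_(m, n)) :
  map_mx d (M + N) = map_mx d M + map_mx d N.
Proof. by apply/matrixP=> i j; rewrite !mxE derD. Qed.

Lemma map_derN m n (M : 'M[A]_(m, n)) : map_mx d (- M) = - map_mx d M.
Proof. by apply/matrixP=> i j; rewrite !mxE derN. Qed.

Lemma map_derB m n (M N : 'M[A]_(m, n)) :
  map_mx d (M - N) = map_mx d M - map_mx d N.
Proof. by rewrite map_derD map_derN. Qed.

Lemma map_derM m n p (M : 'M[A]_(m, n)) (N : 'M[A]_(n, p)) :
  map_mx d (M *m N) = map_mx d M *m N + M *m map_mx d N.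
Proof.
apply/matrixP=> i j; rewrite !mxE der_sum -big_split /=.
by apply: eq_bigr => k _; rewrite !mxE derM.
Qed.

Lemma map_der1 n : map_mx d (1%:M : 'M[A]_n) = 0.
Proof.
apply/matrixP=> i j; rewrite !mxE.
by case: (i == j); rewrite ?der1 ?der0.
Qed.

Lemma map_derZ m n a (M : 'M[A]_(m, n)) :
  map_mx d (a *: M) = d a *: M + a *: map_mx d M.
Proof. by apply/matrixP=> i j; rewrite !mxE derM. Qed.

Lemma map_der_sum m n I (r : seq I) (P : pred I) (F : I -> 'M[A]_(m, n)) :
  map_mx d (\sum_(i <- r | P i) F i) = \sum_(i <- r | P i) map_mx d (F i).
Proof.
apply/matrixP=> i j; rewrite mxE !summxE der_sum.
by apply: eq_bigr => k _; rewrite mxE.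
Qed.

Lemma der_mxtrace n (M : 'M[A]_n) : d (\tr M) = \tr (map_mx d M).
Proof. by rewrite der_sum; apply: eq_bigr => i _; rewrite mxE. Qed.

End Derivation.

Lemma mxDE (A : zmodType) m n (M N : 'M[A]_(m, n)) i j :
  (M + N) i j = M i j + N i j.
Proof. by rewrite mxE. Qed.

Lemma mxNE (A : zmodType) m n (M : 'M[A]_(m, n)) i j :
  (- M) i j = - M i j.
Proof. by rewrite mxE. Qed.

Section Formulas.
Variables (A : comNzRingType) (n : nat) (half : A).
Variables (d : 'I_n -> A -> A) (g h : 'M[A]_n).

(** These formulas copy the coordinate ones term by term, so that evaluation at a point carries one
    to the other. The inverse metric is a parameter [h], as the elements of [A] need not be
    invertible. *)
Definition chr k i j : A :=
  half * \sum_m h k m * (d i (g j m) + d j (g i m) - d m (g i j)).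

Definition rm13 i j k l : A :=
  d k (chr i l j) - d l (chr i k j)
  + \sum_m (chr i k m * chr m l j - chr i l m * chr m k j).

Definition rm04 i j k l : A := \sum_m g i m * rm13 m j k l.

Definition ric j l : A := \sum_i \sum_k h i k * rm04 i j k l.

Definition hes f i j : A := d i (d j f) - \sum_k chr k i j * d k f.

Definition nab4 (T : 'I_n -> 'I_n -> 'I_n -> 'I_n -> A) m i j k l : A :=
  d m (T i j k l)
  - \sum_a (chr a m i * T a j k l + chr a m j * T i a k l
            + chr a m k * T i j a l + chr a m l * T i j k a).

Definition dv4 T j k l : A := \sum_m \sum_i h m i * nab4 T m i j k l.

Definition soliton_mx f : 'M[A]_n := \matrix_(i, j) (ric i j + hes f i j).

(* The Christoffel symbols as connection matrices acting on covector columns: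
   row j, column i of [conn k] is Gamma^i_kj. *)
Definition conn k : 'M[A]_n := \matrix_(j, i) chr i k j.

End Formulas.

Section Connection.
Variables (A : comNzRingType) (n : nat) (d : 'I_n -> A -> A).
Variable C : 'I_n -> 'M[A]_n.

(* For [C = conn], row j, column i of [curv k l] is R^i_jkl. *)
Definition curv k l : 'M[A]_n :=
  map_mx (d k) (C l) - map_mx (d l) (C k) - (C k *m C l - C l *m C k).

Definition nab2 k (S : 'M[A]_n) : 'M[A]_n :=
  map_mx (d k) S - C k *m S - S *m (C k)^T.

(** Differentiates the curvature as an endomorphism only: [k] and [l] are mere labels here, and
    their Christoffel terms are added in [nab_curv]. *)
Definition conn_curv m k l : 'M[A]_n :=
  map_mx (d m) (curv k l) - C m *m curv k l + curv k l *m C m.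

Lemma curvN k l : curv l k = - curv k l.
Proof. by rewrite /curv; apply/matrixP=> i j; rewrite !(mxDE, mxNE); ring. Qed.

Hypothesis d_der : forall i, derivation (d i).
Hypothesis d_comm : forall i j a, d i (d j a) = d j (d i a).

Lemma map_d_comm m p i j (M : 'M[A]_(m, p)) :
  map_mx (d i) (map_mx (d j) M) = map_mx (d j) (map_mx (d i) M).
Proof. by apply/matrixP=> a b; rewrite !mxE d_comm. Qed.

Lemma nab2_0 k : nab2 k 0 = 0.
Proof.
rewrite /nab2 mulmx0 mul0mx !subr0.
by apply/matrixP=> i j; rewrite !mxE (der0 (d_der k)).
Qed.

Definition covd k (v : 'cV[A]_n) : 'cV[A]_n := map_mx (d k) v - C k *m v.

(** The commutator of d_k - C_k and d_l - C_l; the minus sign comes from the action on covectors. *)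
Lemma covd_comm k l v :
  covd k (covd l v) - covd l (covd k v) = - (curv k l *m v).
Proof.
rewrite /covd /curv !(map_derB (d_der _), map_derM (d_der _)) (map_d_comm l k).
rewrite !(mulmxDl, mulmxDr, mulNmx, mulmxN, mulmxA, opprD, opprK).
by apply/matrixP=> i j; rewrite !(mxDE, mxNE); ring.
Qed.

(** Ricci identity for a tensor with two lower indices: the curvature acts on each of them. *)
Lemma nab2_comm k l (S : 'M[A]_n) :
  nab2 k (nab2 l S) - nab2 l (nab2 k S) = - (curv k l *m S + S *m (curv k l)^T).
Proof.
rewrite /nab2 /curv !(map_derB (d_der _), map_derM (d_der _)).
rewrite !(raddfB (@trmx A n n)) /= !trmx_mul !map_trmx (map_d_comm l k).
rewrite !(mulmxDl, mulmxDr, mulNmx, mulmxN, mulmxA, opprD, opprK).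
by apply/matrixP=> i j; rewrite !(mxDE, mxNE); ring.
Qed.

Lemma conn_curvN m k l : conn_curv m l k = - conn_curv m k l.
Proof.
rewrite /conn_curv (curvN k l) (map_derN (d_der m)) mulmxN mulNmx.
by rewrite !opprD.
Qed.

(** Jacobi identity for the operators d_k - C_k. It holds for any connection; torsion freeness
    enters only when the form indices are differentiated too, in [bianchi2]. *)
Lemma conn_curv_cyclic m k l :
  conn_curv m k l + conn_curv k l m + conn_curv l m k = 0.
Proof.
rewrite /conn_curv /curv !(map_derB (d_der _), map_derM (d_der _)).
rewrite (map_d_comm k m) (map_d_comm l m) (map_d_comm l k).
rewrite !(mulmxDl, mulmxDr, mulNmx, mulmxN, mulmxA).
by apply/matrixP=> i j; rewrite !(mxDE, mxNE) [RHS]mxE; ring.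
Qed.

End Connection.

Section Identities.
Variables (A : comNzRingType) (n : nat) (half : A).
Variables (d : 'I_n -> A -> A) (g h : 'M[A]_n).
Hypothesis halfP : half + half = 1.
Hypothesis d_der : forall i, derivation (d i).
Hypothesis g_sym : g^T = g.
Hypothesis gh : g *m h = 1%:M.

Local Notation chr := (chr half d g h).
Local Notation C := (conn half d g h).
Local Notation F := (curv d C).
Local Notation ric := (ric half d g h).
Local Notation hes := (hes half d g h).
Local Notation D := (nab2 d C).
Local Notation rm13 := (rm13 half d g h).
Local Notation rm04 := (rm04 half d g h).
Local Notation T := (soliton_mx half d g h).

Lemma hg : h *m g = 1%:M. Proof. exact: mulmx1C. Qed.

Lemma h_sym : h^T = h.
Proof.
have : h^T *m g = 1%:M by rewrite -{1}g_sym -trmx_mul gh trmx1.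
by move=> e; rewrite -[h^T]mulmx1 -gh mulmxA e mul1mx.
Qed.

Lemma gE i j : g i j = g j i. Proof. by rewrite -{1}g_sym mxE. Qed.
Lemma hE i j : h i j = h j i. Proof. by rewrite -{1}h_sym mxE. Qed.

Lemma chr_sym k i j : chr k i j = chr k j i.
Proof.
congr (_ * _); apply: eq_bigr => m _; congr (_ * _).
by rewrite (gE i j) (addrC (d i _)).
Qed.

Lemma conn_sym k l j : C k l j = C l k j.
Proof. by rewrite !mxE chr_sym. Qed.

(** Lowering the upper index cancels [h] and leaves the Christoffel symbols of the first kind. *)
Lemma conn_g k i j :
  (C k *m g) i j = half * (d k (g i j) + d i (g k j) - d j (g k i)).
Proof.
rewrite !mxE.
under eq_bigr => m _ do rewrite mxE /chr -mulrA big_distrl /=.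
rewrite -big_distrr /= exchange_big /=; congr (_ * _).
have e m : \sum_p h p m * g p j = (j == m)%:R.
  have /matrixP/(_ j m) := gh; rewrite !mxE => <-.
  by apply: eq_bigr => p _; rewrite gE mulrC.
rewrite (eq_bigr (fun m => (d k (g i m) + d i (g k m) - d m (g k i))
                           * (j == m)%:R)) => [|m _]; last first.
  rewrite -e big_distrr /=; apply: eq_bigr => p _; ring.
rewrite (bigD1 j) //= eqxx mulr1 big1 ?addr0 // => m /negbTE.
by rewrite eq_sym => ->; rewrite mulr0.
Qed.

Lemma halfK (a : A) : half * a + half * a = a.
Proof. by rewrite -mulrDl halfP mul1r. Qed.

(** Symmetrizing [conn_g] in [i] and [j] cancels the other two derivatives and doubles that of
    [g i j]. *)
Lemma metric_compat k : map_mx (d k) g = C k *m g + g *m (C k)^T.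
Proof.
have -> : g *m (C k)^T = (C k *m g)^T by rewrite trmx_mul g_sym.
apply/matrixP=> i j; rewrite mxDE [(_^T) i j]mxE !conn_g mxE.
by rewrite (gE j i) -[LHS]halfK; ring.
Qed.

(* Koszul's formula. *)
Lemma levi_civita_unique (C' : 'I_n -> 'M[A]_n) :
  (forall k l j, C' k l j = C' l k j) ->
  (forall k, map_mx (d k) g = C' k *m g + g *m (C' k)^T) ->
  forall k, C' k = C k.
Proof.
move=> C'_sym C'_g k.
suff e : C' k *m g = C k *m g.
  by rewrite -[LHS]mulmx1 -gh mulmxA e -mulmxA gh mulmx1.
have Gs a b c : (C' a *m g) b c = (C' b *m g) a c.
  by rewrite !mxE; apply: eq_bigr => m _; rewrite C'_sym.
have dg a b c : d a (g b c) = (C' a *m g) b c + (C' a *m g) c b.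
  have /matrixP/(_ b c) := C'_g a.
  by rewrite !mxDE mxE => ->; congr (_ + _); rewrite -{1}g_sym -trmx_mul mxE.
apply/matrixP=> i j; rewrite conn_g !dg.
rewrite (Gs i k j) (Gs i j k) (Gs k j i).
by rewrite -[LHS]halfK; ring.
Qed.

Lemma metric_inv_compat k : map_mx (d k) h = - (h *m C k + (C k)^T *m h).
Proof.
have := map_derM (d_der k) g h; rewrite gh (map_der1 (d_der k)).
rewrite metric_compat => /esym/eqP; rewrite addrC addr_eq0 => /eqP e.
rewrite -[LHS]mul1mx -hg -mulmxA e mulmxN; congr (- _).
rewrite mulmxDl mulmxDr !mulmxA -(mulmxA _ g h) gh mulmx1.
by rewrite hg mul1mx.
Qed.

Lemma curvE k l j i : F k l j i = rm13 i j k l.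
Proof.
rewrite !mxE /rm13; congr (_ + _).
rewrite -sumrB -sumrN; apply: eq_bigr => m _.
by rewrite !mxE; ring.
Qed.

Hypothesis d_comm : forall i j a, d i (d j a) = d j (d i a).

Lemma nab2_metric k : D k g = 0.
Proof. by rewrite /nab2 metric_compat addrAC addrK subrr. Qed.

Lemma rm04E i j k l : rm04 i j k l = (F k l *m g) j i.
Proof.
by rewrite mxE; apply: eq_bigr => m _; rewrite curvE gE mulrC.
Qed.

(** The Ricci identity applied to the metric, which is parallel. *)
Lemma curv_g_antisym k l : (F k l *m g)^T = - (F k l *m g).
Proof.
have := nab2_comm C d_der d_comm k l g; rewrite !nab2_metric !nab2_0 // subrr.
move=> /esym/eqP; rewrite oppr_eq0 addrC addr_eq0 => /eqP <-.
by rewrite trmx_mul g_sym.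
Qed.

Lemma ricE j l : ric j l = \sum_m F m l j m.
Proof.
rewrite /ric exchange_big /=; apply: eq_bigr => k _.
have -> : F k l = (F k l *m g) *m h by rewrite -mulmxA gh mulmx1.
rewrite [RHS]mxE; apply: eq_bigr => i _.
by rewrite rm04E mulrC.
Qed.

(** By antisymmetry the curvature is conjugate to minus its transpose, so its trace is its own
    opposite; the element 1/2 then gives zero. *)
Lemma curv_trace k l : \tr (F k l) = 0.
Proof.
have e : (F k l) = - (g *m (F k l)^T *m h).
  rewrite -[LHS]mulmx1 -gh mulmxA -[in LHS](opprK (F k l *m g)).
  by rewrite -curv_g_antisym trmx_mul g_sym mulNmx.
have := mxtrace_tr (F k l).
set t := \tr (F k l) => e1.
have : t = - t.
  rewrite {1}/t e raddfN /= -mulmxA mxtrace_mulC -mulmxA hg mulmx1.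
  by rewrite mxtrace_tr.
move=> e2; have : t + t = 0 by rewrite {1}e2 addNr.
by move=> e3; rewrite -[t]halfK -mulrDr e3 mulr0.
Qed.

Lemma bianchi1 i j k l : F k l j i + F l j k i + F j k l i = 0.
Proof.
rewrite !curvE /rm13 (chr_sym i l j) (chr_sym i k j) (chr_sym i k l).
set s1 := \sum_m _; set s2 := \sum_m _; set s3 := \sum_m _.
have e : s1 + s2 + s3 = 0.
  rewrite -!big_split /= big1 // => m _.
  by rewrite (chr_sym m l j) (chr_sym m k j) (chr_sym m k l); ring.
by rewrite -[RHS]e; ring.
Qed.

(** Trace of the first Bianchi identity: the antisymmetric part of Ric is a trace of the curvature
    endomorphism, which vanishes. *)
Lemma ric_sym j l : ric j l = ric l j.
Proof.
rewrite !ricE; apply/eqP; rewrite -subr_eq0 -sumrB.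
rewrite (eq_bigr (fun m => - F l j m m)) => [|m _].
  by rewrite sumrN -[\sum_i _]/(\tr _) curv_trace oppr0.
have := bianchi1 m j m l; rewrite (curvN d C m j) mxNE => e.
by apply/eqP; rewrite -subr_eq0 opprK -e; apply/eqP; ring.
Qed.

Lemma hes_sym f i j : hes f i j = hes f j i.
Proof.
rewrite /hes d_comm; congr (_ - _); apply: eq_bigr => k _.
by rewrite chr_sym.
Qed.

Lemma soliton_mx_sym f : (T f)^T = T f.
Proof. by apply/matrixP=> i j; rewrite !mxE ric_sym hes_sym. Qed.

(** The full covariant derivative of the curvature, all four indices included. *)
Definition nab_curv m k l : 'M[A]_n :=
  conn_curv d C m k l - \sum_a chr a m k *: F a l - \sum_a chr a m l *: F k a.

Lemma nab_curvN m k l : nab_curv m l k = - nab_curv m k l.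
Proof.
have sN a (X : 'I_n -> A) :
    \sum_e X e *: F a e = - \sum_e X e *: F e a.
  by rewrite -sumrN; apply: eq_bigr => e _; rewrite -scalerN -curvN.
rewrite /nab_curv conn_curvN // !sN.
by rewrite !opprD !opprK addrAC.
Qed.

(** Added to [conn_curv_cyclic], the six form-index corrections cancel in pairs, by the symmetry of
    the Christoffel symbols and the antisymmetry of the curvature. *)
Lemma bianchi2 m k l : nab_curv m k l + nab_curv k l m + nab_curv l m k = 0.
Proof.
have sN a (X : 'I_n -> A) :
    \sum_e X e *: F a e = - \sum_e X e *: F e a.
  by rewrite -sumrN; apply: eq_bigr => e _; rewrite -scalerN -curvN.
have cs a b (X : 'I_n -> 'M[A]_n) :
    \sum_c chr c a b *: X c = \sum_c chr c b a *: X c.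
  by apply: eq_bigr => c _; rewrite chr_sym.
rewrite -(conn_curv_cyclic C d_der d_comm m k l) /nab_curv !sN.
rewrite (cs l k) (cs m k) (cs m l).
move: (\sum_a _) (\sum_a _) (\sum_a _) (conn_curv _ _ _ _ _)
  (conn_curv _ _ _ _ _) (conn_curv _ _ _ _ _) => X Y Z U V W.
by apply/matrixP=> i j; rewrite !(mxDE, mxNE); ring.
Qed.

End Identities.

(** * The soliton tensor and Simons' identity *)

Section Soliton.
Variables (A : comNzRingType) (n : nat) (half : A).
Variables (d : 'I_n -> A -> A) (g h : 'M[A]_n).
Hypothesis halfP : half + half = 1.
Hypothesis d_der : forall i, derivation (d i).
Hypothesis g_sym : g^T = g.
Hypothesis gh : g *m h = 1%:M.
Hypothesis d_comm : forall i j a, d i (d j a) = d j (d i a).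

Local Notation chr := (chr half d g h).
Local Notation C := (conn half d g h).
Local Notation F := (curv d C).
Local Notation ric := (ric half d g h).
Local Notation hes := (hes half d g h).
Local Notation D := (nab2 d C).
Local Notation rm04 := (rm04 half d g h).
Local Notation T := (soliton_mx half d g h).
Local Notation nab_curv := (nab_curv half d g h).

Let metric_compat := metric_compat d halfP g_sym gh.
Let metric_inv_compat := metric_inv_compat halfP d_der g_sym gh.
Let chr_sym := chr_sym half d h g_sym.

(** Lowering an index commutes with covariant differentiation because the metric is parallel. *)
Lemma nab2_curv_g m k l : D m (F k l *m g) = conn_curv d C m k l *m g.
Proof.
rewrite /nab2 /conn_curv (map_derM (d_der m)) metric_compat.
rewrite !(mulmxDl, mulmxDr, mulNmx, mulmxA).
by apply/matrixP=> i j; rewrite !(mxDE, mxNE); ring.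
Qed.

Lemma nab4_rm04 e m i j k l :
  nab4 half d g h (fun i j k l => e * rm04 i j k l) m i j k l
  = ((d m e *: F k l + e *: nab_curv m k l) *m g) j i.
Proof.
have W a b c c' : e * rm04 a b c c' = e * (F c c' *m g) b a.
  by rewrite (rm04E half d h g_sym).
rewrite /nab4 W (derM (d_der m)) [in RHS]mulmxDl [RHS]mxDE -![in RHS]scalemxAl -addrA.
congr (_ + _); first by rewrite [RHS]mxE.
have -> : (e *: (nab_curv m k l *m g)) j i =
   e * ((D m (F k l *m g)) j i - \sum_a chr a m k * (F a l *m g) j i
                               - \sum_a chr a m l * (F k a *m g) j i).
  rewrite mxE nab2_curv_g !mulmxDl !mulNmx !mxDE !mxNE !mulmx_suml !summxE.
  congr (_ * (_ - _ - _)); apply: eq_bigr => a _;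
  by rewrite -scalemxAl [LHS]mxE.
rewrite /nab2 !mxDE !mxNE [(map_mx _ _) j i]mxE.
have -> : (C m *m (F k l *m g)) j i = \sum_a chr a m j * (F k l *m g) a i.
  by rewrite mxE; apply: eq_bigr => a _; rewrite [C m _ _]mxE.
have -> : (F k l *m g *m (C m)^T) j i = \sum_a chr a m i * (F k l *m g) j a.
  rewrite mxE; apply: eq_bigr => a _.
  by rewrite [_^T _ _]mxE [C m _ _]mxE mulrC.
rewrite !mulrBr !big_distrr /= -!addrA -!opprD -!big_split /=.
congr (_ - _); apply: eq_bigr => a _.
by rewrite !W; ring.
Qed.

(** The contraction with [h] undoes the lowering by [g], so the divergence is a trace of the
    curvature endomorphisms. *)
Lemma dv4_rm04 e j k l :
  dv4 half d g h (fun i j k l => e * rm04 i j k l) j k l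
  = \sum_m (d m e * F k l j m + e * nab_curv m k l j m).
Proof.
apply: eq_bigr => m _.
under eq_bigr => i _ do rewrite nab4_rm04 mulrC (hE g_sym gh).
transitivity (((d m e *: F k l + e *: nab_curv m k l) *m g *m h) j m).
  by rewrite [RHS]mxE.
by rewrite -mulmxA gh mulmx1 !mxE.
Qed.

Definition ric_mx : 'M[A]_n := \matrix_(i, j) ric i j.
Definition hes_mx f : 'M[A]_n := \matrix_(i, j) hes f i j.

Lemma nab2E k S i j :
  D k S i j = d k (S i j) - \sum_a chr a k i * S a j - \sum_a chr a k j * S i a.
Proof.
rewrite !mxE; congr (_ - _ - _); apply: eq_bigr => a _; rewrite !mxE //.
by rewrite mulrC.
Qed.

(** Contraction commutes with covariant differentiation: the Christoffel terms of the contracted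
    upper index and of the contracted form index cancel. *)
Lemma nab_curv_trace k j l : \sum_m nab_curv k m l j m = D k ric_mx j l.
Proof.
rewrite nab2E !mxE.
under eq_bigr => m _ do rewrite !(mxDE, mxNE) [(map_mx _ _) _ _]mxE.
rewrite !big_split /= !sumrN.
have ricE' := ricE half d g_sym gh.
have -> : \sum_a d k (F a l j a) = d k (ric j l).
  by rewrite ricE' (der_sum (d_der k)).
have -> : \sum_m (C k *m F m l) j m = \sum_a chr a k j * ric_mx a l.
  under eq_bigr => m _ do rewrite [(_ *m _) _ _]mxE.
  rewrite exchange_big; apply: eq_bigr => a _ /=.
  by rewrite [ric_mx _ _]mxE ricE' big_distrr [C k _ _]mxE.
have -> : \sum_m (F m l *m C k) j m = \sum_m \sum_a chr m k a * F m l j a.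
  apply: eq_bigr => m _; rewrite mxE; apply: eq_bigr => a _.
  by rewrite [C k _ _]mxE mulrC.
have -> : \sum_m (\sum_a chr a k m *: F a l) j m
          = \sum_m \sum_a chr m k a * F m l j a.
  rewrite [RHS]exchange_big; apply: eq_bigr => m _.
  by rewrite summxE; apply: eq_bigr => a _; rewrite [LHS]mxE.
have -> : \sum_m (\sum_a chr a k l *: F m a) j m = \sum_a chr a k l * ric_mx j a.
  under eq_bigr => m _ do rewrite summxE.
  rewrite exchange_big; apply: eq_bigr => a _ /=.
  rewrite [ric_mx _ _]mxE ricE' big_distrr; apply: eq_bigr => m _.
  by rewrite [LHS]mxE.
by ring.
Qed.

Lemma hesE f i j : hes f i j = covd d C i (\col_j d j f) j 0.
Proof.
rewrite mxDE mxNE !mxE; congr (_ - _); apply: eq_bigr => m _.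
by rewrite !mxE.
Qed.

(** The Ricci identity for the covector df. The corrections for the direction index agree on both
    sides by the symmetry of the Christoffel symbols. *)
Lemma nab2_hes f k l j :
  D k (hes_mx f) j l - D l (hes_mx f) j k = - \sum_m F k l j m * d m f.
Proof.
pose v : 'cV[A]_n := \col_j d j f.
have DDE a b : D a (hes_mx f) j b = covd d C a (covd d C b v) j 0
     - \sum_m chr m a b * hes f j m.
  rewrite nab2E [covd d C a _ j 0]mxDE mxNE; congr (_ - _ - _).
  - by rewrite [hes_mx _ _ _]mxE [RHS]mxE (hes_sym half h g_sym d_comm) hesE.
  - rewrite [RHS]mxE; apply: eq_bigr => m _.
    by rewrite [hes_mx _ _ _]mxE (hes_sym half h g_sym d_comm) hesE [C a _ _]mxE.
  - by apply: eq_bigr => m _; rewrite [hes_mx _ _ _]mxE.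
rewrite !DDE; under [X in _ - (_ - X)]eq_bigr do rewrite chr_sym.
have /matrixP/(_ j 0) := covd_comm C d_der d_comm k l v.
rewrite [LHS]mxDE !mxNE => e.
rewrite opprB addrA subrK e mxE; congr (- _); apply: eq_bigr => m _.
by rewrite [v _ _]mxE.
Qed.

Lemma nab2D k X Y : D k (X + Y) = D k X + D k Y.
Proof.
rewrite /nab2 (map_derD (d_der k)) mulmxDl mulmxDr.
by apply/matrixP=> i j; rewrite !(mxDE, mxNE); ring.
Qed.

(** [e] stands for exp(-f), known only through its derivatives. Its derivative contributes minus the
    curvature applied to df, which is the commutator of [nab2_hes]; the second Bianchi identity,
    traced, gives the Ricci part. *)
Lemma dv4_weighted f e j k l :
  (forall i, d i e = - d i f * e) ->
  dv4 half d g h (fun i j k l => e * rm04 i j k l) j k l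
  = e * (D k (T f) j l - D l (T f) j k).
Proof.
move=> de.
have -> : T f = ric_mx + hes_mx f by apply/matrixP=> a b; rewrite !mxE.
have -> : D k (ric_mx + hes_mx f) j l - D l (ric_mx + hes_mx f) j k
    = (D k ric_mx j l - D l ric_mx j k) - \sum_m F k l j m * d m f.
  by rewrite -nab2_hes !nab2D [(D k ric_mx + _)%R j l]mxDE [(D l _ + _) j k]mxDE; ring.
rewrite dv4_rm04 big_split /= addrC.
rewrite mulrDr mulrN -big_distrr /=; congr (_ + _).
  congr (_ * _); rewrite -!nab_curv_trace -sumrB; apply: eq_bigr => m _.
  have := bianchi2 half h d_der g_sym d_comm m k l.
  rewrite (nab_curvN half g h d_der k m l).
  move: (nab_curv m k l) (nab_curv k m l) (nab_curv l m k) => X Y Z.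
  move=> /matrixP/(_ j m); rewrite !(mxDE, mxNE) [RHS]mxE => e0.
  by apply/eqP; rewrite -subr_eq0 -e0; apply/eqP; ring.
rewrite big_distrr -sumrN; apply: eq_bigr => m _ /=.
by rewrite de; ring.
Qed.

(** * Codazzi tensors of constant trace *)

Section Codazzi.
Variable S : 'M[A]_n.
Hypothesis S_sym : S^T = S.
Hypothesis S_codazzi : forall j k l, D k S j l = D l S j k.
Hypothesis S_trace : forall k, d k (\tr (S *m h)) = 0.

Let SE i j : S i j = S j i. Proof. by rewrite -{1}S_sym mxE. Qed.

Lemma nab2_sym k X : X^T = X -> (D k X)^T = D k X.
Proof.
move=> X_sym; rewrite /nab2 !(raddfB (@trmx A n n)) /= !trmx_mul trmxK.
by rewrite map_trmx X_sym addrAC.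
Qed.

Lemma der_trace k X : d k (\tr (X *m h)) = \tr (D k X *m h).
Proof.
rewrite (der_mxtrace (d_der k)) (map_derM (d_der k)) metric_inv_compat.
rewrite /nab2 !(mulmxDl, mulmxDr, mulNmx, mulmxN, mulmxA, opprD) !mxtraceD !raddfN /=.
by rewrite -(mulmxA (C k)) (mxtrace_mulC (C k)) addrA.
Qed.

(** With one index raised, [Z *m h] is an endomorphism; its connection term is a commutator with
    [C k] and disappears under the trace. *)
Lemma der_trace2 k X Y : d k (\tr (X *m h *m (Y *m h))) =
  \tr (D k X *m h *m (Y *m h)) + \tr (X *m h *m (D k Y *m h)).
Proof.
have dh Z : map_mx (d k) (Z *m h) = D k Z *m h + C k *m (Z *m h) - Z *m h *m C k.
  rewrite (map_derM (d_der k)) metric_inv_compat /nab2.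
  rewrite !(mulmxDl, mulmxDr, mulNmx, mulmxN, mulmxA, opprD).
  by apply/matrixP=> i j; rewrite !(mxDE, mxNE); ring.
rewrite (der_mxtrace (d_der k)) (map_derM (d_der k)) !dh.
rewrite !(mulmxDl _ _ (Y *m h)) !mulmxDr !(mulNmx, mulmxN) !mxtraceD !raddfN /=.
rewrite -(mulmxA (C k)) (mxtrace_mulC (C k)) -(mulmxA (_ *m h) (C k)).
rewrite (mulmxA (X *m h) (Y *m h)).
by ring.
Qed.

Local Notation B k := (D k S).

(** The second covariant derivative: [D l] treats [k] as a label, and the sum supplies the
    Christoffel term of that index. *)
Definition nab2_2 l k : 'M[A]_n := D l (B k) - \sum_a chr a l k *: B a.

(** The contraction over [k] and [l] of the commutator of the derivatives in directions [l] and [i],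
    applied to the entry [k j] of S. *)
Definition curv_act : 'M[A]_n := \matrix_(i, j)
  - \sum_k \sum_l h k l * (F l i *m S + S *m (F l i)^T) k j.

Lemma nab2_2E l k i j : nab2_2 l k i j =
  d l (B k i j) - \sum_a chr a l i * B k a j - \sum_a chr a l j * B k i a
  - \sum_a chr a l k * B a i j.
Proof.
rewrite /nab2_2 [LHS]mxDE (nab2E l (B k)) mxNE summxE; congr (_ - _).
by apply: eq_bigr => a _; rewrite [LHS]mxE.
Qed.

Let BE k i j : B k i j = B k j i.
Proof. by rewrite -[in LHS](nab2_sym k S_sym) mxE. Qed.

Lemma nab2_2_sym l k i j : nab2_2 l k i j = nab2_2 l k j i.
Proof.
rewrite !nab2_2E BE; congr (_ - _); last first.
  by apply: eq_bigr => a _; rewrite BE.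
by rewrite [LHS]addrAC; congr (_ - _ - _); apply: eq_bigr => a _; rewrite BE.
Qed.

(** The covariant derivative of the Codazzi equation: exchanging [k] and [i] exchanges the
    correction sums of these two indices. *)
Lemma nab2_2_codazzi l k i j : nab2_2 l k i j = nab2_2 l i k j.
Proof.
have Bki a b c : B a b c = B b a c by rewrite BE S_codazzi BE.
rewrite !nab2_2E (Bki k).
set x := d l _; set a1 := \sum_a _; set a2 := \sum_a _; set a3 := \sum_a _.
set b1 := \sum_a _; set b2 := \sum_a _; set b3 := \sum_a _.
have -> : b1 = a3 by apply: eq_bigr => a _; rewrite Bki.
have -> : b2 = a2 by apply: eq_bigr => a _; rewrite Bki.
have -> : b3 = a1 by apply: eq_bigr => a _; rewrite Bki.
by ring.
Qed.

Lemma nab2_2_comm l i k j : nab2_2 l i k j =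
  nab2_2 i l k j - (F l i *m S + S *m (F l i)^T) k j.
Proof.
have := nab2_comm C d_der d_comm l i S => /matrixP/(_ k j).
rewrite [LHS]mxDE !mxNE => e.
rewrite [nab2_2 l i k j]mxDE [nab2_2 i l k j]mxDE !mxNE -e.
have -> : \sum_a chr a l i *: B a = \sum_a chr a i l *: B a.
  by apply: eq_bigr => a _; rewrite chr_sym.
by ring.
Qed.

Lemma nab2_2_trace i j : \tr (nab2_2 i j *m h) = 0.
Proof.
have Bh k : \tr (B k *m h) = 0 by rewrite -der_trace S_trace.
rewrite mulmxDl mulNmx raddfB /= -der_trace Bh (der0 (d_der i)) add0r.
rewrite mulmx_suml (raddf_sum (@mxtrace A n)) big1 ?oppr0 // => a _ /=.
by rewrite -scalemxAl mxtraceZ Bh mulr0.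
Qed.

(* The Codazzi equation moves the contracted indices onto [S]; commuting the two
   derivatives leaves the Hessian of the trace, which vanishes, and curvature. *)
Lemma nab2_2_lap : \sum_k \sum_l h k l *: nab2_2 l k = curv_act.
Proof.
have e k l i j : nab2_2 l k i j =
    nab2_2 i j k l - (F l i *m S + S *m (F l i)^T) k j.
  rewrite nab2_2_codazzi nab2_2_comm; congr (_ - _).
  by rewrite nab2_2_sym nab2_2_codazzi nab2_2_sym.
apply/matrixP=> i j; rewrite [RHS]mxE summxE -sumrN -[RHS]add0r.
rewrite -[X in X + _](nab2_2_trace i j) -big_split /=; apply: eq_bigr => k _.
rewrite summxE [(_ *m h) k k]mxE -sumrN -big_split /=; apply: eq_bigr => l _.
by rewrite [LHS]mxE (e k l i j) (hE g_sym gh l k); ring.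
Qed.

(** The Laplacian is split into coordinate second derivatives and a gradient term: at a maximum the
    gradient term vanishes and the second derivatives are those that the maximum controls. *)
Lemma simons :
  \sum_k \sum_l h k l * d l (d k (\tr (S *m h *m (S *m h))))
  = \sum_k \sum_l h k l * \sum_a chr a l k * d a (\tr (S *m h *m (S *m h)))
  + (\sum_k \sum_l h k l * \tr (B k *m h *m (B l *m h))
     + \tr (curv_act *m h *m (S *m h))) *+ 2.
Proof.
have d1 k : d k (\tr (S *m h *m (S *m h))) = \tr (B k *m h *m (S *m h)) *+ 2.
  by rewrite der_trace2 mulr2n [in X in _ + X]mxtrace_mulC.
have d2 l k : d l (\tr (B k *m h *m (S *m h))) =
    (\sum_a chr a l k * \tr (B a *m h *m (S *m h))
     + \tr (nab2_2 l k *m h *m (S *m h))) + \tr (B k *m h *m (B l *m h)).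
  rewrite der_trace2; congr (_ + _).
  have -> : D l (B k) = nab2_2 l k + \sum_a chr a l k *: B a by rewrite subrK.
  move: (nab2_2 l k) => N.
  rewrite !mulmxDl mxtraceD addrC; congr (_ + _).
  rewrite !mulmx_suml (raddf_sum (@mxtrace A n)); apply: eq_bigr => a _ /=.
  by rewrite -!scalemxAl mxtraceZ.
have -> : \tr (curv_act *m h *m (S *m h)) =
    \sum_k \sum_l h k l * \tr (nab2_2 l k *m h *m (S *m h)).
  rewrite -nab2_2_lap !mulmx_suml (raddf_sum (@mxtrace A n)).
  apply: eq_bigr => k _; rewrite !mulmx_suml (raddf_sum (@mxtrace A n)).
  by apply: eq_bigr => l _ /=; rewrite -!scalemxAl mxtraceZ.
rewrite -big_split -sumrMnl -big_split; apply: eq_bigr => k _ /=.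
rewrite -big_split -sumrMnl -big_split; apply: eq_bigr => l _ /=.
rewrite d1 mulr2n (derD (d_der l)) d2.
under eq_bigr => a _ do rewrite d1 mulr2n mulrDr.
rewrite big_split /=.
by ring.
Qed.

End Codazzi.
End Soliton.

(** * Change of frame *)

(* [d] and [d'] are the coordinate derivations of two charts on their overlap:
   d/dx_i = sum_a (dy_a / dx_i) d/dy_a. *)
Section FrameChange.
Variables (A : comNzRingType) (n : nat) (half : A).
Variables (d d' : 'I_n -> A -> A) (g h g' h' J K : 'M[A]_n) (y : 'I_n -> A).
Hypothesis halfP : half + half = 1.
Hypothesis d_der : forall i, derivation (d i).
Hypothesis d_comm : forall i j a, d i (d j a) = d j (d i a).
Hypothesis g_sym : g^T = g.
Hypothesis gh : g *m h = 1%:M.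
Hypothesis g'_sym : g'^T = g'.
Hypothesis gh' : g' *m h' = 1%:M.
Hypothesis JK : J *m K = 1%:M.
Hypothesis JE : forall i a, J i a = d i (y a).
Hypothesis dE : forall i x, d i x = \sum_a J i a * d' a x.
Hypothesis g_frame : g = J *m g' *m J^T.

Local Notation C := (conn half d g h).
Local Notation C' := (conn half d' g' h').

Let KJ : K *m J = 1%:M. Proof. exact: mulmx1C. Qed.

Let d'E a x : d' a x = \sum_i K a i * d i x.
Proof.
under eq_bigr => i _ do rewrite dE big_distrr /=.
rewrite exchange_big /= (eq_bigr (fun b => (K *m J) a b * d' b x)).
  rewrite KJ (bigD1 a) //= big1 => [|b /negbTE ab].
    by rewrite mxE eqxx mul1r addr0.
  by rewrite mxE eq_sym ab mul0r.
by move=> b _; rewrite mxE big_distrl; apply: eq_bigr => i _; rewrite mulrA.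
Qed.

Lemma map_dE m p i (M : 'M[A]_(m, p)) :
  map_mx (d i) M = \sum_a J i a *: map_mx (d' a) M.
Proof.
apply/matrixP=> r s; rewrite mxE dE summxE.
by apply: eq_bigr => a _; rewrite !mxE.
Qed.

Lemma map_d'E m p a (M : 'M[A]_(m, p)) :
  map_mx (d' a) M = \sum_i K a i *: map_mx (d i) M.
Proof.
apply/matrixP=> r s; rewrite mxE d'E summxE.
by apply: eq_bigr => i _; rewrite !mxE.
Qed.

(* The connection transported to the second frame is torsion free and metric,
   hence is its Levi-Civita connection. *)
Lemma conn_frame k :
  C k *m J = map_mx (d k) J + J *m \sum_a J k a *: C' a.
Proof.
(* [Z k] is [J] times the transported connection matrix in direction [k]. Torsion freeness becomes
   its symmetry [Z_sym], which holds because [J] is a Jacobian matrix and the derivations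
   commute. *)
pose Z k := C k *m J - map_mx (d k) J.
pose C'' a := \sum_k K a k *: (K *m Z k).
have Z_sym p l c : Z p l c = Z l p c.
  rewrite [LHS]mxDE [RHS]mxDE !mxNE !mxE !JE d_comm; congr (_ - _).
  by apply: eq_bigr => m _; rewrite (conn_sym half d h g_sym).
have C''_sym a b c : C'' a b c = C'' b a c.
  have e p q : C'' p q c = \sum_m \sum_l K p m * K q l * Z m l c.
    rewrite summxE; apply: eq_bigr => m _; rewrite mxE mxE big_distrr /=.
    by apply: eq_bigr => l _; rewrite mulrA.
  rewrite !e exchange_big; apply: eq_bigr => m _; apply: eq_bigr => l _ /=.
  by rewrite Z_sym (mulrC (K a _)).
have Z_g p : J *m map_mx (d p) g' *m J^T = Z p *m g' *m J^T + J *m g' *m (Z p)^T.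
  have := metric_compat d halfP g_sym gh p.
  rewrite {1 3 4}g_frame !(map_derM (d_der p)) -map_trmx.
  rewrite /Z (raddfB (@trmx A n n)) /= trmx_mul.
  move: (C p) => Cp.
  rewrite !(mulmxDl, mulmxDr, mulNmx, mulmxN, mulmxA).
  move=> /matrixP e; apply/matrixP=> i j; have := e i j.
  rewrite !(mxDE, mxNE) => e0; apply/eqP; rewrite -subr_eq0; apply/eqP.
  move/eqP: e0; rewrite -subr_eq0 => /eqP e0; rewrite -[RHS]e0.
  by ring.
have C''_g a : map_mx (d' a) g' = C'' a *m g' + g' *m (C'' a)^T.
  have KZ p : map_mx (d p) g' = K *m Z p *m g' + g' *m (K *m Z p)^T.
    have e : K *m (J *m map_mx (d p) g' *m J^T) *m K^T = map_mx (d p) g'.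
      rewrite !mulmxA KJ mul1mx -mulmxA -trmx_mul KJ trmx1 mulmx1 //.
    rewrite -[LHS]e Z_g mulmxDr mulmxDl trmx_mul !mulmxA KJ mul1mx.
    by rewrite -[X in X + _]mulmxA -trmx_mul KJ trmx1 mulmx1.
  rewrite map_d'E /C'' (raddf_sum (@trmx A n n)) mulmx_suml mulmx_sumr.
  rewrite -big_split; apply: eq_bigr => p _ /=.
  by rewrite KZ scalerDr linearZ /= -scalemxAl -scalemxAr.
have C''E a : C'' a = C' a.
  by rewrite (levi_civita_unique halfP g'_sym gh' C''_sym C''_g).
have -> : \sum_a J k a *: C' a = K *m Z k.
  under eq_bigr => a _ do rewrite -C''E scaler_sumr.
  rewrite exchange_big /= (eq_bigr (fun m => (J *m K) k m *: (K *m Z m))).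
    rewrite JK (bigD1 k) //= big1 => [|b /negbTE ab].
      by rewrite mxE eqxx scale1r addr0.
    by rewrite mxE eq_sym ab scale0r.
  move=> m _; rewrite mxE scaler_suml; apply: eq_bigr => a _.
  by rewrite scalerA.
by rewrite mulmxA JK mul1mx addrC subrK.
Qed.

(** By [conn_frame], the connection [Ct] is the gauge transform of [C] by [J], so the two curvatures
    are conjugate. The curvature of [Ct] is then expanded in the directions of the second frame. *)
Lemma curv_frame k l :
  curv d C k l *m J = J *m \sum_a \sum_b (J k a * J l b) *: curv d' C' a b.
Proof.
pose Ct k := \sum_a J k a *: C' a.
have CJ p : C p *m J = map_mx (d p) J + J *m Ct p by exact: conn_frame.
have dJ p q : map_mx (d p) (C q) *m J = map_mx (d p) (map_mx (d q) J)
    + map_mx (d p) J *m Ct q + J *m map_mx (d p) (Ct q)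
    - C q *m map_mx (d p) J.
  have := congr1 (map_mx (d p)) (CJ q).
  rewrite (map_derM (d_der p)) (map_derD (d_der p)) (map_derM (d_der p)).
  by move/(canRL (addrK _)) => ->; rewrite addrA.
have -> : curv d C k l *m J =
    J *m (map_mx (d k) (Ct l) - map_mx (d l) (Ct k)
          - (Ct k *m Ct l - Ct l *m Ct k)).
  rewrite !mulmxBl !dJ -!mulmxA !CJ !mulmxDr !mulmxA !CJ.
  rewrite (map_d_comm d_comm k l).
  rewrite !(mulmxDl, mulmxDr, mulNmx, mulmxN, mulmxA).
  by apply/matrixP=> i j; rewrite !(mxDE, mxNE); ring.
congr (_ *m _).
have dCt p q : map_mx (d p) (Ct q) = \sum_b d p (J q b) *: C' b
     + \sum_a \sum_b (J p a * J q b) *: map_mx (d' a) (C' b).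
  rewrite (map_der_sum (d_der p)) exchange_big -big_split /=.
  apply: eq_bigr => b _; rewrite (map_derZ (d_der p)); congr (_ + _).
  rewrite map_dE scaler_sumr; apply: eq_bigr => a _.
  by rewrite scalerA mulrC.
have CtM p q : Ct p *m Ct q = \sum_a \sum_b (J p a * J q b) *: (C' a *m C' b).
  rewrite mulmx_suml; apply: eq_bigr => a _; rewrite mulmx_sumr.
  apply: eq_bigr => b _; rewrite -scalemxAl -scalemxAr scalerA //.
rewrite !dCt !CtM.
(* The non-tensorial terms cancel because [J] is a Jacobian matrix. *)
have -> : \sum_b d k (J l b) *: C' b = \sum_b d l (J k b) *: C' b.
  by apply: eq_bigr => b _; rewrite !JE d_comm.
rewrite [X in _ + X - (_ + _) - _]exchange_big /=.
rewrite opprD addrACA subrr add0r.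
rewrite [X in X - _ - _]exchange_big /=.
rewrite [X in _ - X - _]exchange_big [X in _ - (_ - X)]exchange_big /=.
rewrite -!sumrB; apply: eq_bigr => a _; rewrite -!sumrB; apply: eq_bigr => b _.
by rewrite !scalerBr !(mulrC (J l _)).
Qed.

Lemma ric_frame : ric_mx half d g h = J *m ric_mx half d' g' h' *m J^T.
Proof.
apply/matrixP=> j l; rewrite [LHS]mxE (ricE half d g_sym gh).
have FE m : curv d C m l = J *m (\sum_a \sum_b (J m a * J l b) *: curv d' C' a b) *m K.
  by rewrite -curv_frame -mulmxA JK mulmx1.
under eq_bigr => m _.
  rewrite FE mulmx_sumr mulmx_suml summxE.
  under eq_bigr => a _ do rewrite mulmx_sumr mulmx_suml summxE.
  over.
rewrite exchange_big /=; under eq_bigr => a _ do rewrite exchange_big /=.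
rewrite exchange_big /=.
rewrite [RHS]mxE; apply: eq_bigr => b _; rewrite [_^T _ _]mxE.
transitivity (\sum_a J l b * (J *m curv d' C' a b *m (K *m J)) j a).
  apply: eq_bigr => a _.
  rewrite mulmxA [in RHS]mxE big_distrr; apply: eq_bigr => m _ /=.
  by rewrite -scalemxAr -scalemxAl mxE; ring.
rewrite KJ -big_distrr mulrC; congr (_ * _) => /=.
under eq_bigr => a _ do rewrite mulmx1 mxE.
rewrite exchange_big mxE; apply: eq_bigr => c _ /=.
by rewrite -big_distrr mxE (ricE half d' g'_sym gh').
Qed.

(** The derivative of [J] produced by differentiating df in the new frame cancels against the
    inhomogeneous term of [conn_frame]. *)
Lemma hes_frame f : hes_mx half d g h f = J *m hes_mx half d' g' h' f *m J^T.
Proof.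
rewrite -[LHS]trmxK -[RHS]trmxK; congr (_^T).
apply/matrixP=> j k; rewrite 2![LHS]mxE hesE.
have -> : \col_i d i f = J *m \col_i d' i f.
  apply/matrixP=> i c; rewrite !mxE dE; apply: eq_bigr => a _.
  by rewrite !mxE.
set v := \col_i _.
have -> : covd d C k (J *m v) = J *m \sum_a J k a *: covd d' C' a v.
  rewrite /covd (map_derM (d_der k)) mulmxA conn_frame mulmxDl opprD addrACA.
  rewrite subrr add0r -mulmxA -mulmxBr map_dE mulmx_suml -sumrB; congr (_ *m _).
  by apply: eq_bigr => a _; rewrite scalerBr scalemxAl.
rewrite !trmx_mul trmxK [LHS]mxE [RHS]mxE; apply: eq_bigr => c _.
congr (_ * _); rewrite summxE [RHS]mxE; apply: eq_bigr => a _.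
by rewrite [LHS]mxE ![_^T _ _]mxE [hes_mx _ _ _ _ _ _ _]mxE hesE mulrC.
Qed.

Lemma soliton_mx_frame f :
  soliton_mx half d g h f = J *m soliton_mx half d' g' h' f *m J^T.
Proof.
have e D G H : soliton_mx half D G H f = ric_mx half D G H + hes_mx half D G H f.
  by apply/matrixP=> i j; rewrite !mxE.
by rewrite !e mulmxDr mulmxDl ric_frame hes_frame.
Qed.

End FrameChange.

(** * Naturality under ring morphisms compatible with the derivations *)

Section Naturality.
Variables (A B : comNzRingType) (phi : {rmorphism A -> B}) (n : nat).
Variables (half : A) (d : 'I_n -> A -> A) (d' : 'I_n -> B -> B) (g h : 'M[A]_n).
Hypothesis phi_d : forall i a, phi (d i a) = d' i (phi a).

Lemma chr_morph k i j : phi (chr half d g h k i j) =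
  chr (phi half) d' (map_mx phi g) (map_mx phi h) k i j.
Proof.
rewrite rmorphM rmorph_sum; congr (_ * _); apply: eq_bigr => m _.
by rewrite !mxE rmorphM rmorphB rmorphD !phi_d.
Qed.

Lemma rm13_morph i j k l : phi (rm13 half d g h i j k l) =
  rm13 (phi half) d' (map_mx phi g) (map_mx phi h) i j k l.
Proof.
rewrite rmorphD rmorphB !phi_d !chr_morph rmorph_sum; congr (_ + _).
by apply: eq_bigr => m _; rewrite rmorphB; congr (_ - _); rewrite [LHS]rmorphM !chr_morph.
Qed.

Lemma ric_morph j l : phi (ric half d g h j l) =
  ric (phi half) d' (map_mx phi g) (map_mx phi h) j l.
Proof.
rewrite rmorph_sum; apply: eq_bigr => i _; rewrite rmorph_sum.
apply: eq_bigr => k _; rewrite rmorphM mxE rmorph_sum; congr (_ * _).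
by apply: eq_bigr => m _; rewrite rmorphM mxE rm13_morph.
Qed.

Lemma hes_morph f i j : phi (hes half d g h f i j) =
  hes (phi half) d' (map_mx phi g) (map_mx phi h) (phi f) i j.
Proof.
rewrite rmorphB !phi_d rmorph_sum; congr (_ - _).
by apply: eq_bigr => k _; rewrite rmorphM chr_morph phi_d.
Qed.

Lemma soliton_mx_morph f : map_mx phi (soliton_mx half d g h f) =
  soliton_mx (phi half) d' (map_mx phi g) (map_mx phi h) (phi f).
Proof. by apply/matrixP=> i j; rewrite !mxE rmorphD ric_morph hes_morph. Qed.

End Naturality.

(** * Simultaneous diagonalization and the curvature inequality *)

Definition posdef (R : realFieldType) n (G : 'M[R]_n) : Prop :=
  forall v : 'rV[R]_n, v != 0 -> 0 < (v *m G *m v^T) 0 0.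

Lemma posdef_unitmx (R : realFieldType) n (G : 'M[R]_n) :
  posdef G -> G \in unitmx.
Proof.
move=> Gpos; rewrite -row_free_unit -kermx_eq0; apply: contraT => /rowV0Pn[v].
move=> /sub_kermxP vG0 v0; have := Gpos v v0.
by rewrite vG0 mul0mx mxE ltxx.
Qed.

Lemma bilinear_sym (R : comNzRingType) n (M : 'M[R]_n) (u v : 'rV[R]_n) :
  M^T = M -> (u *m M *m v^T) 0 0 = (v *m M *m u^T) 0 0.
Proof.
move=> M_sym; transitivity ((u *m M *m v^T)^T 0 0); first by rewrite [RHS]mxE.
by rewrite !trmx_mul trmxK M_sym mulmxA.
Qed.

Lemma bilinearE (R : comNzRingType) m n (M : 'M[R]_(m, n)) u v :
  (u *m M *m v^T) (0 : 'I_1) (0 : 'I_1) =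
  \sum_i \sum_j u 0 i * M i j * v 0 j.
Proof.
rewrite mxE exchange_big; apply: eq_bigr => j _ /=.
by rewrite !mxE big_distrl.
Qed.

Lemma row_conj (R : comNzRingType) m n (E : 'M[R]_(m, n)) (M : 'M[R]_n) a b :
  (E *m M *m E^T) a b = (row a E *m M *m (row b E)^T) 0 0.
Proof.
by rewrite mxE [RHS]mxE; apply: eq_bigr => j _; rewrite -row_mul !mxE.
Qed.

Section GeneralizedEigenvector.
Variables (R : rcfType) (n : nat).

Let re (w : 'rV[R[i]]_n) : 'rV[R]_n := map_mx (@complex.Re R) w.
Let im (w : 'rV[R[i]]_n) : 'rV[R]_n := map_mx (@complex.Im R) w.

Let ReM (z : R[i]) (x : R) : complex.Re (z * real_complex R x) = complex.Re z * x.
Proof. by case: z => a b /=; rewrite mulr0 subr0. Qed.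
Let ImM (z : R[i]) (x : R) : complex.Im (z * real_complex R x) = complex.Im z * x.
Proof. by case: z => a b /=; rewrite mulr0 add0r. Qed.

Let reM w (M : 'M[R]_n) : re (w *m map_mx (real_complex R) M) = re w *m M.
Proof.
apply/matrixP=> i j; rewrite !mxE raddf_sum; apply: eq_bigr => k _.
by rewrite !mxE; exact: ReM.
Qed.
Let imM w (M : 'M[R]_n) : im (w *m map_mx (real_complex R) M) = im w *m M.
Proof.
apply/matrixP=> i j; rewrite !mxE raddf_sum; apply: eq_bigr => k _.
by rewrite !mxE; exact: ImM.
Qed.
Let reZ z w : re (z *: w) = complex.Re z *: re w - complex.Im z *: im w.
Proof. by apply/matrixP=> i j; rewrite !mxE; case: z (w i j) => a b [c e]. Qed.
Let imZ z w : im (z *: w) = complex.Re z *: im w + complex.Im z *: re w.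
Proof.
by apply/matrixP=> i j; rewrite !mxE; case: z (w i j) => a b [c e] /=; rewrite (mulrC b).
Qed.

(* A symmetric pencil has a real eigenvector: the imaginary part of a complex
   eigenvalue, times a positive number, vanishes by symmetry. *)
Lemma symmetric_pencil_eigenvector (G S : 'M[R]_n) :
  (0 < n)%N -> posdef G -> G^T = G -> S^T = S ->
  exists (v : 'rV[R]_n) mu, v != 0 /\ v *m S = mu *: (v *m G).
Proof.
move=> n_gt0 Gpos Gsym Ssym.
have Gunit := posdef_unitmx Gpos.
pose Ac := map_mx (real_complex R) (S *m invmx G).
have [z /eigenvalueP[w wA w0]] : exists z, eigenvalue Ac z.
  have [z rz] : exists z, root (char_poly Ac) z.
    apply/closed_rootP; rewrite size_char_poly.
    by case: (n) n_gt0.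
  by exists z; rewrite eigenvalue_root_char.
have wS : w *m map_mx (real_complex R) S = z *: (w *m map_mx (real_complex R) G).
  rewrite scalemxAl -wA /Ac -mulmxA -map_mxM -mulmxA mulVmx //.
  by rewrite mulmx1.
have eR := congr1 re wS; have eI := congr1 im wS.
rewrite reZ !(reM, imM) in eR; rewrite imZ !(reM, imM) in eI.
set a := re w in eR eI; set b := im w in eR eI.
set x := complex.Re z in eR eI; set t := complex.Im z in eR eI.
have ge0 (u : 'rV[R]_n) : 0 <= (u *m G *m u^T) 0 0.
  have [->|/Gpos/ltW//] := eqVneq u 0; by rewrite !mul0mx mxE.
have ab0 : (a != 0) || (b != 0).
  apply: contraR w0; rewrite negb_or !negbK => /andP[/eqP a0 /eqP b0].
  apply/eqP/matrixP=> i j; rewrite mxE.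
  have := congr1 (fun M : 'rV_n => M i j) a0; rewrite !mxE => ea.
  have := congr1 (fun M : 'rV_n => M i j) b0; rewrite !mxE => eb.
  by apply/eqP; rewrite eq_complex ea eb !eqxx.
have t0 : t = 0.
  pose q (M : 'M[R]_n) (u v : 'rV[R]_n) : R := (u *m M *m v^T) 0 0.
  have e1 : q S a b = x * q G a b - t * q G b b.
    by rewrite /q eR mulmxBl -!scalemxAl mxE [X in _ + X]mxE [X in X - _]mxE
               [X in _ - X]mxE.
  have e2 : q S b a = x * q G b a + t * q G a a.
    by rewrite /q eI mulmxDl -!scalemxAl mxE [X in _ + X]mxE [X in X + _]mxE.
  have e3 : t * (q G a a + q G b b) = 0.
    move: e1; rewrite /q (bilinear_sym a b Ssym) -/(q S b a) e2.
    by rewrite /q (bilinear_sym a b Gsym) => e1; lra.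
  move/eqP: e3; rewrite mulf_eq0 => /orP[/eqP//|].
  rewrite paddr_eq0 ?ge0 // => /andP[/eqP qa /eqP qb].
  by case/orP: ab0 => /Gpos; rewrite -/(q G _ _) ?qa ?qb ltxx.
exists (if a != 0 then a else b), x.
rewrite t0 scale0r subr0 in eR; rewrite t0 scale0r addr0 in eI.
by move: ab0; case: ifP.
Qed.
End GeneralizedEigenvector.

(** Induction on the dimension: an eigenvector [v] of the pencil is split off. Since v S is a
    multiple of v G, the [G]-orthogonal complement of [v] is also [S]-orthogonal to it, and both
    forms restrict. *)
Lemma simultaneous_diag (R : rcfType) n (G S : 'M[R]_n) :
  posdef G -> G^T = G -> S^T = S ->
  exists E : 'M[R]_n, E *m G *m E^T = 1%:M /\ is_diag_mx (E *m S *m E^T).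
Proof.
elim: n => [|n IHn] in G S *; move=> Gpos Gsym Ssym.
  by exists 1%:M; split; [apply/matrixP=> -[] | apply/is_diag_mxP=> -[]].
have [v [mu [v0 vS]]] := symmetric_pencil_eigenvector (ltn0Sn n) Gpos Gsym Ssym.
have vv := Gpos v v0.
pose N := G *m v^T.
(* The rows of [B] form a basis of the [G]-orthogonal complement of [v]. *)
have [B Bfree BN] : exists2 B : 'M[R]_(n, n.+1), row_free B & B *m N = 0.
  have rkN : \rank N = 1%N.
    apply/eqP; rewrite eqn_leq rank_leq_col lt0n mxrank_eq0.
    apply: contraTN vv => /eqP N0.
    by rewrite -mulmxA -/N N0 mulmx0 mxE ltxx.
  have rk : \rank (kermx N) = n by rewrite mxrank_ker rkN subn1.
  (* The row base of the kernel has [\rank (kermx N)] rows, equal to [n] only by a proof; [gen]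
     changes the type accordingly. *)
  have gen r (B : 'M[R]_(r, n.+1)) : r = n -> row_free B -> B *m N = 0 ->
      exists2 B : 'M[R]_(n, n.+1), row_free B & B *m N = 0.
    by move=> rn; rewrite rn in B * => Bf BN; exists B.
  apply: (gen _ (row_base (kermx N)) rk); first exact: row_base_free.
  by apply/sub_kermxP; rewrite eq_row_base.
have [||| E [EG ES]] := IHn (B *m G *m B^T) (B *m S *m B^T).
- move=> u u0; have := Gpos (u *m B).
  rewrite trmx_mul !mulmxA; apply.
  by apply: contraNneq u0 => /eqP; rewrite mulmx_free_eq0.
- by rewrite !trmx_mul trmxK Gsym mulmxA.
- by rewrite !trmx_mul trmxK Ssym mulmxA.
pose s := Num.sqrt ((v *m G *m v^T) 0 0).
have s0 : s != 0 by rewrite sqrtr_eq0 -ltNge.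
have vG1 : s^-1 *: v *m G *m (s^-1 *: v)^T = 1%:M.
  rewrite linearZ /= -!scalemxAl -scalemxAr scalerA.
  apply/matrixP=> i j; rewrite !ord1 mxE [RHS]mxE eqxx.
  rewrite -[(v *m G *m v^T) 0 0]sqr_sqrtr ?ltW // -/s expr2.
  by rewrite mulrACA mulVf ?mulr1.
have BGv : B *m G *m v^T = 0 by rewrite -mulmxA.
have vGB : v *m G *m B^T = 0.
  by apply: trmx_inj; rewrite !trmx_mul trmxK Gsym mulmxA BGv trmx0.
have vSB : v *m S *m B^T = 0 by rewrite vS -scalemxAl vGB scaler0.
have BSv : B *m S *m v^T = 0.
  by apply: trmx_inj; rewrite !trmx_mul trmxK Ssym mulmxA vSB trmx0.
have blk (M : 'M[R]_n.+1) : v *m M *m B^T = 0 -> B *m M *m v^T = 0 ->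
    (col_mx (s^-1 *: v) (E *m B) : 'M[R]_(1 + n)) *m M
      *m (col_mx (s^-1 *: v) (E *m B))^T =
    block_mx (s^-1 *: v *m M *m (s^-1 *: v)^T) 0 0
      (E *m (B *m M *m B^T) *m E^T).
  move=> vMB BMv; rewrite mul_col_mx tr_col_mx mul_col_row; congr block_mx.
  - by rewrite trmx_mul mulmxA -2!scalemxAl vMB scaler0 mul0mx.
  - by rewrite linearZ /= -scalemxAr -!mulmxA (mulmxA B) BMv mulmx0 scaler0.
  - by rewrite trmx_mul !mulmxA.
exists (col_mx (s^-1 *: v) (E *m B)); split.
  by rewrite blk // vG1 EG -scalar_mx_block.
rewrite blk //.
set X := (X in block_mx X _ _ _); set Y := (X in block_mx _ _ _ X).
suff: is_diag_mx (block_mx X 0 0 Y : 'M[R]_(1 + n, 1 + n)) by [].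
rewrite is_diag_block_mx // !eqxx /X /Y ES !andbT /=.
by apply/is_diag_mxP=> i j; rewrite !ord1 eqxx.
Qed.

(** * Positivity of the curvature term at a point *)

Section CurvatureInequality.
Variables (R : realFieldType) (n : nat) (g h S E : 'M[R]_n).
Variable F : 'I_n -> 'I_n -> 'M[R]_n.
Hypothesis g_sym : g^T = g.
Hypothesis gh : g *m h = 1%:M.
Hypothesis EgE : E *m g *m E^T = 1%:M.

Lemma frame_inv : h = E^T *m E.
Proof.
have e : g *m E^T *m E = 1%:M by apply: mulmx1C; rewrite mulmxA.
have hg := mulmx1C gh.
by rewrite -[RHS]mul1mx -hg -mulmxA (mulmxA g) e mulmx1.
Qed.

Lemma sqnorm_frame X : \tr (X *m h *m (X *m h)) =
  \tr ((E *m X *m E^T) *m (E *m X *m E^T)).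
Proof. by rewrite frame_inv !mulmxA mxtrace_mulC !mulmxA. Qed.

Lemma mxtrace_sqr_sym (Y : 'M[R]_n) : Y^T = Y ->
  \tr (Y *m Y) = \sum_i \sum_j Y i j ^+ 2.
Proof.
move=> Ysym; apply: eq_bigr => i _; rewrite mxE; apply: eq_bigr => j _.
by rewrite expr2; congr (_ * _); rewrite -{1}Ysym mxE.
Qed.

Lemma frame_conj_sym X : X^T = X -> (E *m X *m E^T)^T = E *m X *m E^T.
Proof. by move=> Xsym; rewrite !trmx_mul trmxK Xsym mulmxA. Qed.

Lemma sqnorm_ge0 X : X^T = X -> 0 <= \tr (X *m h *m (X *m h)).
Proof.
move=> Xsym; rewrite sqnorm_frame mxtrace_sqr_sym ?frame_conj_sym //.
by apply: sumr_ge0 => i _; apply: sumr_ge0 => j _; exact: sqr_ge0.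
Qed.

Lemma frame_conj_eq0 X : E *m X *m E^T = 0 -> X = 0.
Proof.
have e : g *m E^T *m E = 1%:M by apply: mulmx1C; rewrite mulmxA.
have e' : E^T *m E *m g = 1%:M by rewrite -frame_inv; exact: mulmx1C.
move=> X0; have := congr1 (fun Y => (g *m E^T) *m Y *m (E *m g)) X0.
rewrite /= mulmx0 mul0mx !mulmxA e mul1mx -!mulmxA.
by rewrite (mulmxA E^T) e' mulmx1.
Qed.

Lemma sqnorm_eq0 X : X^T = X -> \tr (X *m h *m (X *m h)) = 0 -> X = 0.
Proof.
move=> Xsym; rewrite sqnorm_frame mxtrace_sqr_sym ?frame_conj_sym // => e.
apply: frame_conj_eq0; apply/matrixP=> i j; rewrite [RHS]mxE.
have ge0 k : 0 <= \sum_l (E *m X *m E^T) k l ^+ 2.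
  by apply: sumr_ge0 => l _; exact: sqr_ge0.
have e1 : \sum_l (E *m X *m E^T) i l ^+ 2 = 0.
  by apply: (psumr_eq0P (fun k _ => ge0 k) e).
apply/eqP; rewrite -sqrf_eq0; apply/eqP.
by apply: (psumr_eq0P (fun l _ => sqr_ge0 ((E *m X *m E^T) i l)) e1).
Qed.

(** As h = E^T E, the contraction is the sum over the frame of the squared norms of the combinations
    of the [B k] along each frame vector. *)
Lemma sqnorm_contract_ge0 (B : 'I_n -> 'M[R]_n) :
  (forall k, (B k)^T = B k) ->
  0 <= \sum_k \sum_l h k l * \tr (B k *m h *m (B l *m h)).
Proof.
move=> Bsym.
pose X a := \sum_k E a k *: B k.
have Xsym a : (X a)^T = X a.
  rewrite raddf_sum; apply: eq_bigr => k _ /=.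
  by rewrite linearZ /= Bsym.
have -> : \sum_k \sum_l h k l * \tr (B k *m h *m (B l *m h))
    = \sum_a \tr (X a *m h *m (X a *m h)).
  transitivity (\sum_a \sum_k \sum_l E a k * E a l * \tr (B k *m h *m (B l *m h))).
    rewrite [RHS]exchange_big; apply: eq_bigr => k _ /=.
    rewrite [RHS]exchange_big; apply: eq_bigr => l _ /=.
    rewrite -big_distrl {1}frame_inv mxE; congr (_ * _).
    by apply: eq_bigr => a _; rewrite mxE.
  apply: eq_bigr => a _; rewrite !mulmx_suml (raddf_sum (@mxtrace R n)).
  apply: eq_bigr => k _; rewrite mulmx_sumr (raddf_sum (@mxtrace R n)).
  apply: eq_bigr => l _ /=.
  by rewrite -!scalemxAl -scalemxAr !mxtraceZ mulrA.
by apply: sumr_ge0 => a _; exact: sqnorm_ge0.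
Qed.

Hypothesis S_diag : is_diag_mx (E *m S *m E^T).
Hypothesis F_anti : forall k l, F l k = - F k l.
Hypothesis Fg_anti : forall k l, (F k l *m g)^T = - (F k l *m g).

Let rm i j k l := (F k l *m g) j i.
Let K (u v : 'rV[R]_n) : R := \sum_i \sum_j \sum_k \sum_l
  rm i j k l * u 0 i * v 0 j * u 0 k * v 0 l.

Hypothesis K_gt0 : forall u v, row_free (col_mx u v) ->
  (u *m g *m u^T) 0 0 = 1 -> (v *m g *m v^T) 0 0 = 1 ->
  (u *m g *m v^T) 0 0 = 0 -> 0 < K u v.
Hypothesis S_sym : S^T = S.
Hypothesis S_trace : \tr (S *m h) = 0.

(** The value of [curv_act] at a point. *)
Let G : 'M[R]_n := \matrix_(i, j)
  - \sum_k \sum_l h k l * (F l i *m S + S *m (F l i)^T) k j.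

Let lam a := (E *m S *m E^T) a a.
(** The curvature endomorphism of the frame vectors [a] and [b]; [Kab] is then the sectional
    curvature of their plane, as the frame is orthonormal. *)
Let Fab a b := \sum_l \sum_i (E a l * E b i) *: F l i.
Let Kab a b := (row b E *m (Fab a b *m g) *m (row a E)^T) 0 0.

Let FabE a b k p : (Fab a b *m g) k p =
  \sum_l \sum_i E a l * E b i * (F l i *m g) k p.
Proof.
rewrite mulmx_suml summxE; apply: eq_bigr => l _.
rewrite mulmx_suml summxE; apply: eq_bigr => i _.
by rewrite -scalemxAl [LHS]mxE.
Qed.

Let KabE a b : Kab a b = K (row a E) (row b E).
Proof.
rewrite /K exchange_big /Kab bilinearE.
apply: eq_bigr => k _; apply: eq_bigr => p _ /=.
rewrite FabE big_distrr big_distrl; apply: eq_bigr => l _ /=.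
rewrite big_distrr big_distrl; apply: eq_bigr => i _ /=.
by rewrite /rm ![row _ _ _ _]mxE; ring.
Qed.

Let Fab_g_anti a b : (Fab a b *m g)^T = - (Fab a b *m g).
Proof.
rewrite !mulmx_suml (raddf_sum (@trmx R n n)) -sumrN; apply: eq_bigr => l _ /=.
rewrite !mulmx_suml (raddf_sum (@trmx R n n)) -sumrN; apply: eq_bigr => i _ /=.
by rewrite -scalemxAl linearZ /= Fg_anti scalerN.
Qed.

Let S_row b : S *m (row b E)^T = lam b *: (g *m (row b E)^T).
Proof.
have e : g *m E^T *m E = 1%:M by apply: mulmx1C; rewrite mulmxA.
have SE : S *m E^T = g *m E^T *m (E *m S *m E^T).
  by rewrite !mulmxA e mul1mx.
rewrite tr_row colE mulmxA SE -mulmxA.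
have -> : E *m S *m E^T *m delta_mx b (0 : 'I_1) = lam b *: delta_mx b 0.
  apply/matrixP=> i j; rewrite -colE [LHS]mxE [RHS]mxE
    [delta_mx _ _ _ _]mxE !ord1 eqxx andbT.
  have [->|ib] := eqVneq i b; first by rewrite mulr1.
  by rewrite mulr0 (is_diag_mxP S_diag).
by rewrite -scalemxAr -mulmxA.
Qed.

(** The curvature acts on both indices of S. Each action hits an eigenvector, which replaces S by an
    eigenvalue times the metric, and antisymmetry gives the two terms opposite signs. Diagonal
    entries are enough, as S is diagonal in the frame. *)
Let Gbb b : (E *m G *m E^T) b b = \sum_a (lam b - lam a) * Kab a b.
Proof.
pose W l i := F l i *m S + S *m (F l i)^T.
have -> : (E *m G *m E^T) b b = - \sum_a \sum_i \sum_j \sum_k \sum_l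
    E b i * E b j * E a k * E a l * W l i k j.
  rewrite row_conj bilinearE [in RHS]exchange_big -sumrN.
  apply: eq_bigr => i _; rewrite [in RHS]exchange_big -sumrN.
  apply: eq_bigr => j _; rewrite [in RHS]exchange_big [G i j]mxE.
  rewrite mulrN mulNr; congr (- _); rewrite big_distrr big_distrl /=.
  apply: eq_bigr => k _; rewrite [in RHS]exchange_big big_distrr big_distrl /=.
  apply: eq_bigr => l _; rewrite frame_inv [(E^T *m E) k l]mxE big_distrl /= big_distrr /= big_distrl /=.
  by apply: eq_bigr => a _; rewrite ![row _ _ _ _]mxE [E^T _ _]mxE /W /=; ring.
rewrite -sumrN; apply: eq_bigr => a _.
have -> : \sum_i \sum_j \sum_k \sum_l E b i * E b j * E a k * E a l * W l i k j
  = (row a E *m (Fab a b *m S + S *m (Fab a b)^T) *m (row b E)^T) 0 0.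
  have WE k j : (Fab a b *m S + S *m (Fab a b)^T) k j =
      \sum_i \sum_l E a l * E b i * W l i k j.
    rewrite exchange_big /Fab mulmx_suml (raddf_sum (@trmx R n n)) mulmx_sumr.
    rewrite -big_split summxE; apply: eq_bigr => l _ /=.
    rewrite mulmx_suml (raddf_sum (@trmx R n n)) mulmx_sumr.
    rewrite -big_split summxE; apply: eq_bigr => i _ /=.
    by rewrite linearZ /= -scalemxAl -scalemxAr -scalerDr [LHS]mxE.
  rewrite bilinearE; under [RHS]eq_bigr => k _.
    under eq_bigr => j _ do rewrite WE big_distrr big_distrl /=.
    over.
  rewrite /=; under [RHS]eq_bigr => k _ do rewrite exchange_big /=.
  rewrite [RHS]exchange_big; apply: eq_bigr => i _ /=.
  rewrite [RHS]exchange_big; apply: eq_bigr => j _ /=.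
  apply: eq_bigr => k _; rewrite big_distrr big_distrl; apply: eq_bigr => l _ /=.
  by rewrite ![row _ _ _ _]mxE; ring.
rewrite mulmxDr mulmxDl -!mulmxA S_row.
rewrite (mulmxA (row a E) S).
have -> : row a E *m S = lam a *: (row a E *m g).
  apply: trmx_inj; rewrite trmx_mul S_sym S_row [RHS]linearZ /=.
  by rewrite trmx_mul g_sym.
rewrite -!scalemxAl -!scalemxAr mxE [X in X + _]mxE [X in _ + X]mxE.
have e1 : (row a E *m (Fab a b *m (g *m (row b E)^T))) 0 0 = - Kab a b.
  rewrite /Kab -[in RHS](opprK (Fab a b *m g)) -Fab_g_anti mulmxN mulNmx [X in - X]mxE opprK.
  transitivity ((row a E *m (Fab a b *m (g *m (row b E)^T)))^T 0 0).
    by rewrite [RHS]mxE.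
  by rewrite !trmx_mul !trmxK !mulmxA.
have e2 : (row a E *m g *m ((Fab a b)^T *m (row b E)^T)) 0 0 = Kab a b.
  rewrite /Kab; transitivity ((row a E *m g *m ((Fab a b)^T *m (row b E)^T))^T 0 0).
    by rewrite [RHS]mxE.
  by rewrite !trmx_mul !trmxK g_sym !mulmxA.
by rewrite e1 e2; ring.
Qed.

Let Kab_sym a b : Kab b a = Kab a b.
Proof.
have e : Fab b a = - Fab a b.
  rewrite /Fab exchange_big -sumrN; apply: eq_bigr => l _ /=.
  rewrite -sumrN; apply: eq_bigr => i _.
  by rewrite (F_anti l i) scalerN mulrC.
rewrite /Kab e mulNmx -Fab_g_anti.
transitivity ((row a E *m (Fab a b *m g)^T *m (row b E)^T)^T 0 0).
  by rewrite [RHS]mxE.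
by rewrite !trmx_mul !trmxK !mulmxA.
Qed.

Let lam0 : (forall a b, lam a = lam b) -> S = 0.
Proof.
move=> lamE; apply: frame_conj_eq0; apply/matrixP=> i j; rewrite [RHS]mxE.
have [<-|ij] := eqVneq i j; last exact: (is_diag_mxP S_diag).
have : \sum_a lam a = 0.
  by rewrite -[LHS]/(\tr _) -mulmxA mxtrace_mulC -mulmxA -frame_inv.
rewrite (eq_bigr (fun=> lam i)) => [|a _]; last exact: lamE.
rewrite sumr_const card_ord => /eqP; rewrite mulrn_eq0 => /orP[n0|/eqP//].
(* The index [i] excludes dimension zero, so the common eigenvalue is zero. *)
by have := leq_ltn_trans (leq0n i) (ltn_ord i); rewrite lt0n n0.
Qed.

Let Kab_gt0 a b : a != b -> 0 < Kab a b.
Proof.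
move=> ab; rewrite KabE.
have e i j : row i E *m g *m (row j E)^T = (i == j)%:R%:M.
  by apply/matrixP=> p q; rewrite !ord1 -row_conj EgE !mxE eqxx.
apply: K_gt0; rewrite ?e ?eqxx ?(negbTE ab) ?mxE //.
(* Orthonormality makes this a right inverse of the two stacked rows. *)
apply/row_freeP; exists (g *m row_mx (row a E)^T (row b E)^T).
rewrite mulmxA mul_col_mx mul_col_row.
by rewrite !e !eqxx (negbTE ab) eq_sym (negbTE ab) raddf0 -scalar_mx_block.
Qed.

Lemma curv_act_pos : 0 <= \tr (G *m h *m (S *m h)) /\
  (\tr (G *m h *m (S *m h)) = 0 -> S = 0).
Proof.
have -> : \tr (G *m h *m (S *m h)) = \sum_b \sum_a lam b * (lam b - lam a) * Kab a b.
  transitivity (\tr ((E *m G *m E^T) *m (E *m S *m E^T))).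
    by rewrite frame_inv !mulmxA mxtrace_mulC !mulmxA.
  apply: eq_bigr => b _; rewrite mxE (bigD1 b) //= big1 ?addr0 => [|a ab].
    rewrite -/(lam b) Gbb big_distrl; apply: eq_bigr => a _ /=.
    by rewrite mulrC mulrA.
  by rewrite (is_diag_mxP S_diag) ?mulr0.
set Q := \sum_b _.
(* Adding the sum with [a] and [b] exchanged turns lam_b (lam_b - lam_a) into a square, thanks to
   the symmetry of [Kab]. *)
have Q2 : Q + Q = \sum_b \sum_a (lam b - lam a) ^+ 2 * Kab a b.
  rewrite {2}/Q exchange_big /Q -big_split; apply: eq_bigr => b _ /=.
  rewrite -big_split; apply: eq_bigr => a _ /=.
  by rewrite (Kab_sym a b); ring.
have t_ge0 b a : 0 <= (lam b - lam a) ^+ 2 * Kab a b.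
  have [->|ab] := eqVneq a b; first by rewrite subrr expr2 mul0r mul0r.
  by rewrite mulr_ge0 ?sqr_ge0 // ltW // Kab_gt0.
have s_ge0 b : 0 <= \sum_a (lam b - lam a) ^+ 2 * Kab a b.
  exact: sumr_ge0.
split.
  have : 0 <= Q + Q by rewrite Q2; exact: sumr_ge0.
  by move=> ?; lra.
move=> Q0; apply: lam0 => b a.
have e : \sum_b \sum_a (lam b - lam a) ^+ 2 * Kab a b = 0 by rewrite -Q2 Q0 addr0.
have e1 : \sum_a (lam b - lam a) ^+ 2 * Kab a b = 0.
  by apply: (psumr_eq0P (fun b _ => s_ge0 b) e).
have e2 : (lam b - lam a) ^+ 2 * Kab a b = 0.
  by apply: (psumr_eq0P (fun a _ => t_ge0 b a) e1).
have [->//|ab] := eqVneq a b.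
move/eqP: e2; rewrite mulf_eq0 sqrf_eq0 subr_eq0 => /orP[/eqP//|].
by rewrite gt_eqF ?Kab_gt0.
Qed.

End CurvatureInequality.

(** * Smooth functions on open sets of R^n *)

Section OneVariable.
Variable R : realType.

(** Covers both signs of [s]; the weak bound on [c] admits [s = 0] as well. *)
Lemma mvt_at0 (phi dphi : R -> R) (s : R) :
  (forall t : R, `|t| <= `|s| -> is_derive t 1 phi (dphi t)) ->
  exists2 c, `|c| <= `|s| & phi s - phi 0 = dphi c * s.
Proof.
move=> phiD.
have cont t : `|t| <= `|s| -> {for t, continuous phi}.
  move=> ts; apply/differentiable_continuous/derivable1_diffP.
  by have [] := phiD t ts.
have [s0|s0] := leP 0 s.
  have [||c cs ->] := @MVT_segment R phi dphi 0 s s0.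
  - move=> t; rewrite in_itv /= => /andP[t0 ts]; apply: phiD.
      by rewrite (ger0_norm (ltW t0)) (ger0_norm s0) ltW.
  - apply: continuous_in_subspaceT => t.
    rewrite inE /= in_itv /= => /andP[t0 ts]; apply: cont.
    by rewrite (ger0_norm t0) (ger0_norm s0).
  exists c; rewrite ?subr0 //; move: cs; rewrite in_itv /= => /andP[t0 ts].
  by rewrite (ger0_norm t0) (ger0_norm s0).
have [||c cs e] := @MVT_segment R phi dphi s 0 (ltW s0).
- move=> t; rewrite in_itv /= => /andP[t0 ts]; apply: phiD.
  by rewrite (ltr0_norm ts) (ltr0_norm s0) lerN2 ltW.
- apply: continuous_in_subspaceT => t.
  rewrite inE /= in_itv /= => /andP[t0 ts]; apply: cont.
  by rewrite (ler0_norm ts) (ltr0_norm s0) lerN2.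
exists c.
  move: cs; rewrite in_itv /= => /andP[t0 ts].
  by rewrite (ler0_norm ts) (ltr0_norm s0) lerN2.
by rewrite -opprB e sub0r mulrN opprK.
Qed.

(** The first derivative vanishes at 0. Were [D] positive, it would be positive just to the right of
    0, and the mean value theorem would give a value above the maximum. *)
Lemma second_derivative_at_max (psi dpsi : R -> R) (D r : R) : 0 < r ->
  (forall t : R, `|t| < r -> is_derive t 1 psi (dpsi t)) ->
  is_derive (0 : R) 1 dpsi D ->
  (forall t, `|t| < r -> psi t <= psi 0) -> D <= 0.
Proof.
move=> r0 psiD [dpsiD <-] psi_max.
have itv0 : (0 : R) \in `](- r), r[ by rewrite in_itv /= oppr_lt0 r0.
have itvP' t : t \in `](- r), r[ -> `|t| < r.
  by rewrite in_itv /= ltr_norml.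
have rr : - r <= r by lra.
have dpsi0 : dpsi 0 = 0.
  have h1 t : t \in `](- r), r[ -> derivable psi t 1.
    by move=> /itvP'/psiD[].
  have h2 t : t \in `](- r), r[ -> psi t <= psi 0 by move=> /itvP'; exact: psi_max.
  have [_ <-] : is_derive (0 : R) (1 : R) psi (dpsi 0) by apply: psiD; rewrite normr0.
  by have [_ ->] := derive1_at_max rr h1 itv0 h2.
rewrite leNgt; apply/negP => D0.
have : \forall h \near (0 : R)^', 0 < h^-1 *: (dpsi (h *: 1 + 0) - dpsi 0).
  exact: (@cvgr_gt _ _ _ _ _ _ dpsiD _ D0).
rewrite dpsi0 => /nbhs_ballP[e /= e0 He].
pose s := Num.min (e / 2) (r / 2).
have s0 : 0 < s by rewrite lt_min !divr_gt0.
have se : s < e by rewrite gt_min; apply/orP; left; lra.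
have sr : s < r by rewrite gt_min; apply/orP; right; lra.
have [||c] := @MVT R psi dpsi 0 s s0.
- move=> t; rewrite in_itv /= => /andP[t0 ts]; apply: psiD.
  by rewrite gtr0_norm // (lt_trans ts).
- apply: continuous_in_subspaceT => t.
  rewrite inE /= in_itv /= => /andP[t0 ts].
  apply/differentiable_continuous/derivable1_diffP.
  by case: (psiD t) => //; rewrite ger0_norm // (le_lt_trans ts).
rewrite in_itv /= subr0 => /andP[c0 cs] e1.
have : dpsi c * s <= 0.
  by rewrite -e1 subr_le0; apply: psi_max; rewrite gtr0_norm.
rewrite pmulr_lle0 // leNgt => /negP; apply.
have := He c; rewrite subr0 /GRing.scale /= mulr1 addr0 pmulr_rgt0 ?invr_gt0 //.
apply; last by rewrite gt_eqF.
by rewrite /ball /= sub0r normrN gtr0_norm // (lt_trans cs).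
Qed.

End OneVariable.

(** * Differentiability from partial derivatives, and symmetry of second derivatives *)

Section SmoothAnalysis.
Variables (R : realType) (n : nat).
Local Notation rV := 'rV[R]_n.
Local Notation "''e_' i" := (delta_mx 0 i : rV) (at level 8, i at level 2).
Implicit Types (u v : rV -> R) (x p w : rV) (U V : set rV).

Lemma is_derive_line u p w (t : R) : derivable u (p + t *: w) w ->
  is_derive t (1 : R) (fun s : R => u (p + s *: w)) ('D_w u (p + t *: w)).
Proof.
move=> du.
have e : (fun h : R => h^-1 *:
    (((fun s : R => u (p + s *: w)) \o shift t) (h *: (1 : R))
     - u (p + t *: w))) =
    (fun h : R => h^-1 *: ((u \o shift (p + t *: w)) (h *: w)
     - u (p + t *: w))).
  apply/funext => h /=; congr (_ *: (u _ - _)).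
  by rewrite [_ *: 1]mulr1 scalerDl addrCA.
by apply: DeriveDef; rewrite ?/derivable ?/derive e.
Qed.

Lemma near_coordinates x (P : rV -> Prop) : (\forall y \near x, P y) ->
  exists2 r : R, 0 < r & forall y : rV, (forall j, `|y 0 j - x 0 j| < r) -> P y.
Proof.
move=> /nbhs_ballP[r /= r0 xrP]; exists r => // y yx; apply: xrP.
rewrite /ball /= /mx_ball; split=> // i j; rewrite !ord1 /ball /= distrC; exact: yx.
Qed.

Definition partial_path (h : rV) (k : nat) : rV :=
  \row_(j < n) (if (j < k)%N then h 0 j else 0).

Lemma partial_pathS h (k : 'I_n) :
  partial_path h k.+1 = partial_path h k + h 0 k *: 'e_k.
Proof.
apply/matrixP=> i j; rewrite !mxE !ord1 eqxx /= ltnS leq_eqVlt.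
have [->|jk] := eqVneq j k; first by rewrite ltnn eqxx mulr1 add0r.
by rewrite (negbTE (_ : nat_of_ord j != k)) //= mulr0 addr0.
Qed.

(* Mean value theorem along the axis-parallel path from [x] to [x + h]. *)
Lemma mean_value_path u x (h : rV) :
  (forall y : rV, (forall j, `|y 0 j - x 0 j| <= `|h 0 j|) ->
     forall i, derivable u y 'e_i) ->
  exists xi : 'I_n -> rV,
    (forall i j, `|xi i 0 j - x 0 j| <= `|h 0 j|) /\
    u (x + h) - u x = \sum_i h 0 i * pderiv i u (xi i).
Proof.
move=> du.
pose near_x (y : rV) := forall j, `|y 0 j - x 0 j| <= `|h 0 j|.
have step (k : 'I_n) : {xi : rV | near_x xi /\
    u (x + partial_path h k.+1) - u (x + partial_path h k)
    = h 0 k * pderiv k u xi}.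
  apply: cid; pose q := x + partial_path h k.
  have qx (t : R) : `|t| <= `|h 0 k| -> near_x (q + t *: 'e_k).
    move=> th j; rewrite !mxE eqxx /=.
    have [->|jk] := eqVneq j k.
      by rewrite ltnn addr0 mulr1 addrAC subrr add0r.
    by rewrite mulr0 addr0 addrAC subrr add0r; case: ifP; rewrite ?normr0.
  have [c ch e] := @mvt_at0 R (fun t => u (q + t *: 'e_k))
    (fun t => pderiv k u (q + t *: 'e_k)) (h 0 k)
    (fun t th => is_derive_line (du _ (qx t th) k)).
  exists (q + c *: 'e_k); split; first exact: qx.
  by rewrite partial_pathS addrA mulrC -e scale0r addr0.
exists (fun k => sval (step k)); split=> [i|]; first by case: (svalP (step i)).
under eq_bigr => i _ do rewrite -(svalP (step i)).2.
rewrite -(big_mkord xpredT (fun i => u (x + partial_path h i.+1) - u (x + partial_path h i))).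
rewrite telescope_sumr //; congr (u (x + _) - u _).
  by apply/matrixP=> i j; rewrite mxE !ord1 ltn_ord.
by rewrite -[LHS]addr0; congr (_ + _); apply/matrixP=> i j; rewrite !mxE.
Qed.


(** The case of zero differential, to which [differentiable_C1] reduces by subtracting the linear
    part. *)
Lemma differentiable_flat u x :
  (forall e : R, 0 < e -> \forall h \near (0 : rV), `|u (h + x) - u x| <= e * `|h|) ->
  differentiable u x.
Proof.
move=> small.
have e0 : u \o shift x = cst (u x) + (\0 : {linear rV -> R}) +o_ (0 : rV) id.
  apply/eqaddoP => e e_gt0; near=> h.
  rewrite /= !fctE /= addr0; near: h.
  exact: small.
have c0 : continuous (\0 : {linear rV -> R}) by exact: cst_continuous.
apply/diff_locallyP; rewrite (diff_unique c0 e0); split=> //.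
Unshelve. all: by end_near. Qed.

(** The increment of [u - L] is a sum, along the axis-parallel path, of coordinates of [h] times
    variations of partial derivatives, which continuity makes small. *)
Lemma differentiable_C1 u x :
  (\forall y \near x, forall i, derivable u y 'e_i) ->
  (forall i, {for x, continuous (pderiv i u)}) ->
  differentiable u x.
Proof.
move=> du dcont.
pose L (y : rV) : R := \sum_i pderiv i u x *: y 0 i.
have Ldiff y : differentiable L y.
  rewrite /L -fct_sumE; apply: differentiable_sum => i.
  by apply: differentiableZ; exact: differentiable_coord.
rewrite (_ : u = (u - L) + L); last by rewrite subrK.
apply: differentiableD => //; apply: differentiable_flat => e e0.
(* The error is shared among [n] coordinates; [n.+1] avoids a division by zero in dimension zero. *)
pose e' := e / n.+1%:R.
have e'0 : 0 < e' by rewrite divr_gt0.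
have : \forall y \near x, forall i, derivable u y 'e_i /\
    `|pderiv i u x - pderiv i u y| <= e'.
  near=> y => i; split; first by move: i; near: y.
  move: i; near: y; apply: filter_forall => i.
  exact: ((cvgrPdist_le _ _).1 (dcont i) _ e'0).
move=> /near_coordinates[r r0 near_r].
have : \forall h \near (0 : rV), `|h| < r.
  by apply: nbhs0_lt.
apply: filterS => h hr.
have hj j : `|h 0 j| <= `|h|.
  by rewrite [leRHS]/Num.Def.normr /= mx_normrE; exact: (le_bigmax _ _ (0, j)).
have near_h (y : rV) : (forall j, `|y 0 j - x 0 j| <= `|h 0 j|) ->
    forall i, derivable u y 'e_i /\ `|pderiv i u x - pderiv i u y| <= e'.
  by move=> yx; apply: near_r => j; rewrite (le_lt_trans (yx j)) // (le_lt_trans (hj j)).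
have [xi [xix e1]] := mean_value_path (fun y yx i => (near_h y yx i).1).
have -> : (u - L) (h + x) - (u - L) x =
    \sum_i h 0 i * (pderiv i u (xi i) - pderiv i u x).
  transitivity ((u (x + h) - u x) - (L (h + x) - L x)).
    by rewrite !fctE (addrC h x); ring.
  under [RHS]eq_bigr do rewrite mulrBr.
  rewrite e1 sumrB; congr (_ - _).
  rewrite /L -sumrB; apply: eq_bigr => i _.
  by rewrite mxE -scalerBr addrK mulrC.
rewrite (le_trans (ler_norm_sum _ _ _)) //.
apply: (@le_trans _ _ (\sum_(i < n) `|h| * e')).
  apply: ler_sum => i _; rewrite normrM ler_pM // distrC.
  exact: (near_h _ (xix i) i).2.
rewrite sumr_const card_ord -mulrnAr mulrC ler_wpM2r // -mulr_natr /e'.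
by rewrite -mulrA ger_pMr // mulrC ler_pdivrMr // mul1r ler_nat.
Unshelve. all: by end_near. Qed.

(** The mean value theorem is applied in direction [i] to a difference in direction [j], then in
    direction [j] to the partial derivative. The radius is twice [s] because both displacements fall
    on one coordinate when [i = j]. *)
Lemma second_difference u x (r s : R) i j :
  (forall y : rV, (forall k, `|y 0 k - x 0 k| < r) ->
    derivable u y 'e_i /\ derivable (pderiv i u) y 'e_j) ->
  `|s| *+ 2 < r ->
  exists y : rV, (forall k, `|y 0 k - x 0 k| <= `|s| *+ 2) /\
    u (x + s *: 'e_j + s *: 'e_i) - u (x + s *: 'e_i) - (u (x + s *: 'e_j) - u x)
    = pderiv j (pderiv i u) y * s * s.
Proof.
move=> du sr.
have box (a b : R) : `|a| <= `|s| -> `|b| <= `|s| ->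
    forall k, `|(x + a *: 'e_j + b *: 'e_i) 0 k - x 0 k| <= `|s| *+ 2.
  move=> aS bS k.
  rewrite [X in `|X|](_ : _ = a * (k == j)%:R + b * (k == i)%:R); last first.
    by rewrite !mxE eqxx /=; ring.
  rewrite mulr2n (le_trans (ler_normD _ _)) // lerD // normrM.
    by case: (k == j); rewrite ?mulr1 ?mulr0 ?normr1 ?normr0 ?mulr1 ?mulr0.
  by case: (k == i); rewrite ?mulr1 ?mulr0 ?normr1 ?normr0 ?mulr1 ?mulr0.
have box' a b aS bS k := le_lt_trans (box a b aS bS k) sr.
have s0 : `|0 : R| <= `|s| by rewrite normr0.
pose phi (t : R) := u (x + s *: 'e_j + t *: 'e_i) - u (x + t *: 'e_i).
have phiD (t : R) : `|t| <= `|s| -> is_derive t (1 : R) phi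
    (pderiv i u (x + s *: 'e_j + t *: 'e_i) - pderiv i u (x + t *: 'e_i)).
  move=> tS; apply: is_deriveB; apply: is_derive_line.
    exact: (du _ (box' s t (lexx _) tS)).1.
  by have := (du _ (box' 0 t s0 tS)).1; rewrite scale0r addr0.
have [c cS] := mvt_at0 phiD.
rewrite /phi scale0r !addr0 => ->.
have psiD (t : R) : `|t| <= `|s| -> is_derive t (1 : R)
    (fun t : R => pderiv i u (x + c *: 'e_i + t *: 'e_j))
    (pderiv j (pderiv i u) (x + c *: 'e_i + t *: 'e_j)).
  move=> tS; apply: is_derive_line; rewrite addrAC.
  exact: (du _ (box' t c tS cS)).2.
have [c' c'S] := mvt_at0 psiD.
rewrite scale0r addr0 addrAC => ->.
by exists (x + c *: 'e_i + c' *: 'e_j); split=> // k; rewrite addrAC; exact: box.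
Qed.

(** The second difference is symmetric in [i] and [j], so each mixed derivative at some point near
    [x] equals the other one at another such point; continuity at [x] concludes. *)
Lemma clairaut u x i j :
  (\forall y \near x, forall a, derivable u y 'e_a /\
     forall b, derivable (pderiv a u) y 'e_b) ->
  {for x, continuous (pderiv j (pderiv i u))} ->
  {for x, continuous (pderiv i (pderiv j u))} ->
  pderiv i (pderiv j u) x = pderiv j (pderiv i u) x.
Proof.
have absurd (g : R) : 0 < g -> g <= g / 3 + g / 3 -> False by move=> *; lra.
move=> du cji cij; apply/eqP; rewrite -subr_eq0 -normr_le0 leNgt; apply/negP.
set gap := `|_| => gap0.
(* Two errors of a third of the gap cannot add up to it. *)
have e0 : 0 < gap / 3 by rewrite divr_gt0.
have near1 : \forall y \near x,
    `|pderiv j (pderiv i u) x - pderiv j (pderiv i u) y| <= gap / 3.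
  exact: ((cvgrPdist_le _ _).1 cji _ e0).
have near2 : \forall y \near x,
    `|pderiv i (pderiv j u) x - pderiv i (pderiv j u) y| <= gap / 3.
  exact: ((cvgrPdist_le _ _).1 cij _ e0).
have [r r0 near_r] := near_coordinates (filterI du (filterI near1 near2)).
pose s := r / 3.
have s_gt0 : 0 < s by rewrite divr_gt0.
have sr : `|s| *+ 2 < r by rewrite gtr0_norm // /s; lra.
have dij a b (y : rV) : (forall k, `|y 0 k - x 0 k| < r) ->
    derivable u y 'e_a /\ derivable (pderiv a u) y 'e_b.
  by move=> /near_r[/(_ a)[d1 d2] _]; exact: (conj d1 (d2 b)).
have [y [yx ey]] := second_difference (dij i j) sr.
have [z [zx ez]] := second_difference (dij j i) sr.
have yzE : pderiv j (pderiv i u) y = pderiv i (pderiv j u) z.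
  have s2 : s * s != 0 by rewrite mulf_neq0 // gt_eqF.
  move: ey ez; rewrite (addrAC x (s *: 'e_j)).
  move: (pderiv j _ y) (pderiv i _ z) => a b ey ez.
  have ab : a * s * s = b * s * s by rewrite -ey -ez; ring.
  by apply: (mulIf s2); rewrite (mulrA a) (mulrA b).
have [_ [yg _]] := near_r y (fun k => le_lt_trans (yx k) sr).
have [_ [_ zg]] := near_r z (fun k => le_lt_trans (zx k) sr).
have : gap <= gap / 3 + gap / 3.
  rewrite yzE distrC in yg; apply: le_trans (lerD zg yg).
  by rewrite /gap; apply: le_trans (ler_normD _ _); rewrite addrA subrK.
exact: absurd.
Qed.

Lemma gradient_at_max u x (U : set rV) : open U -> U x ->
  (forall i y, U y -> derivable u y 'e_i) -> (forall y, U y -> u y <= u x) ->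
  forall i, pderiv i u x = 0.
Proof.
move=> Uo Ux du umax i.
have [r r0 rU] := near_coordinates (open_nbhs_nbhs (conj Uo Ux)).
have inU (t : R) : t \in `](- r), r[ -> U (x + t *: 'e_i).
  rewrite in_itv /= -ltr_norml => tr; apply: rU => j.
  rewrite !mxE eqxx /= addrAC subrr add0r normrM.
  by case: (j == i); rewrite ?normr1 ?normr0 ?mulr1 ?mulr0.
have itv0 : (0 : R) \in `](- r), r[ by rewrite in_itv /= oppr_lt0 r0.
have rr : - r <= r by lra.
pose psi (t : R) := u (x + t *: 'e_i).
have psiD (t : R) : t \in `](- r), r[ ->
    is_derive t (1 : R) psi (pderiv i u (x + t *: 'e_i)).
  by move=> /inU tU; apply: is_derive_line; exact: du.
have h1 (t : R) : t \in `](- r), r[ -> derivable psi t 1.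
  by move=> /psiD[].
have h2 (t : R) : t \in `](- r), r[ -> psi t <= psi 0.
  by move=> /inU tU; rewrite /psi scale0r addr0; exact: umax.
have [_ e1] := derive1_at_max rr h1 itv0 h2.
by have [_] := psiD 0 itv0; rewrite e1 scale0r addr0.
Qed.

End SmoothAnalysis.

(** * Chain rule and second-order condition at a maximum *)

Section SmoothFunctionsTheory.
Variables (R : realType) (n : nat).
Local Notation rV := 'rV[R]_n.
Local Notation "''e_' i" := (delta_mx 0 i : rV) (at level 8, i at level 2).
Implicit Types (u v : rV -> R) (x p w : rV) (U V : set rV).

Lemma smooth_on_continuous U u x : smooth_on U u -> U x -> {for x, continuous u}.
Proof. by move=> uU Ux; exact: (uU [::] x Ux).1. Qed.

Lemma smooth_on_derivable U u x i : smooth_on U u -> U x -> derivable u x 'e_i.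
Proof. by move=> uU Ux; exact: (uU [::] x Ux).2. Qed.

Lemma smooth_on_pderiv U u i : smooth_on U u -> smooth_on U (pderiv i u).
Proof.
move=> uU s x Ux; have := uU (rcons s i) x Ux.
by rewrite /iter_pderiv foldr_rcons.
Qed.

Lemma smooth_on_differentiable U u x : open U -> smooth_on U u -> U x ->
  differentiable u x.
Proof.
move=> Uo uU Ux; apply: differentiable_C1 => [|i].
  apply: filterS (open_nbhs_nbhs (conj Uo Ux)) => y Uy i.
  exact: smooth_on_derivable uU Uy.
exact: smooth_on_continuous (smooth_on_pderiv i uU) Ux.
Qed.

Lemma derive_gradient u x w : differentiable u x ->
  'D_w u x = \sum_i w 0 i * pderiv i u x.
Proof.
move=> ud; rewrite deriveE // {1}(row_sum_delta w) linear_sum.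
apply: eq_bigr => i _; rewrite linearZ /=; congr (_ * _).
by rewrite /pderiv deriveE.
Qed.

(** Restriction to the line through [x] in direction [w] reduces this to one variable. *)
Lemma hessian_at_max U u x w : open U -> smooth_on U u -> U x ->
  (forall y, U y -> u y <= u x) ->
  \sum_i \sum_j w 0 i * w 0 j * pderiv j (pderiv i u) x <= 0.
Proof.
move=> Uo uU Ux umax.
have : \forall t \near (0 : R), U (x + t *: w).
  have cont : {for (0 : R), continuous (fun t : R => x + t *: w)}.
    apply: cvgD; first exact: cvg_cst.
    exact: cvgZr_tmp.
  by apply: cont; rewrite scale0r addr0; exact: open_nbhs_nbhs.
move=> /nbhs_ballP[r /= r0 rU].
have inU (t : R) : `|t| < r -> U (x + t *: w).
  by move=> tr; apply: rU; rewrite /ball /= sub0r normrN.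
pose psi (t : R) := u (x + t *: w).
have psiD (t : R) : `|t| < r -> is_derive t (1 : R) psi
    (\sum_i w 0 i *: pderiv i u (x + t *: w)).
  move=> /inU tU; have ud := smooth_on_differentiable Uo uU tU.
  rewrite -derive_gradient //; apply: is_derive_line.
  exact: diff_derivable.
apply: (second_derivative_at_max r0 psiD).
  under eq_bigr => i _.
    under eq_bigr => j _ do rewrite -mulrA.
    rewrite -big_distrr /=; over.
  rewrite -[X in is_derive _ _ X _]fct_sumE.
  apply: is_derive_sum => i; apply: is_deriveZ.
  have ud : differentiable (pderiv i u) x.
    exact: smooth_on_differentiable (smooth_on_pderiv i uU) Ux.
  rewrite -(derive_gradient _ ud).
  have := @is_derive_line R n (pderiv i u) x w 0; rewrite scale0r addr0.
  by apply; exact: diff_derivable.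
by move=> t /inU tU; rewrite /psi scale0r addr0; exact: umax.
Qed.

Lemma differentiable_rV (F : rV -> rV) x :
  (forall a, differentiable (fun y => F y 0 a) x) -> differentiable F x.
Proof.
move=> dF.
have -> : F = \sum_a (fun y => F y 0 a *: 'e_a).
  by apply/funext => y; rewrite fct_sumE -row_sum_delta.
by apply: differentiable_sum => a; apply: differentiableZl.
Qed.

Lemma pderiv_comp (F : rV -> rV) u x i :
  (forall a, differentiable (fun y => F y 0 a) x) -> differentiable u (F x) ->
  pderiv i (u \o F) x = \sum_a pderiv i (fun y => F y 0 a) x * pderiv a u (F x).
Proof.
move=> dFa du; have dF := differentiable_rV dFa.
rewrite /pderiv deriveE; last exact: differentiable_comp.
rewrite diff_comp //= -deriveE // derive_gradient //; apply: eq_bigr => a _.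
congr (_ * _); rewrite -deriveE // derive_mx; last exact: diff_derivable.
by rewrite mxE.
Qed.

Lemma jacobianE (F : rV -> rV) x i a :
  (forall a, differentiable (fun y => F y 0 a) x) ->
  ('J F x) i a = pderiv i (fun y => F y 0 a) x.
Proof.
move=> dFa; have dF := differentiable_rV dFa.
have := deriveEjacobian 'e_i dF; rewrite -rowE => /matrixP/(_ 0 a).
rewrite [RHS]mxE => <-; rewrite derive_mx; last exact: diff_derivable.
by rewrite mxE.
Qed.

End SmoothFunctionsTheory.

(** * Closure properties of smooth functions *)

Section SmoothClosure.
Variables (R : realType) (n : nat).
Local Notation rV := 'rV[R]_n.
Local Notation "''e_' i" := (delta_mx 0 i : rV) (at level 8, i at level 2).
Implicit Types (u v : rV -> R) (x : rV) (U V : set rV).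

(** A recursion on the order of differentiation, so that closure under products, inverses and
    compositions follows by induction from the formula for a first derivative. *)
Fixpoint smooth_upto (N : nat) U u : Prop :=
  (forall x, U x -> {for x, continuous u}) /\
  if N is N'.+1 then
    (forall i x, U x -> derivable u x 'e_i) /\
    (forall i, smooth_upto N' U (pderiv i u))
  else True.

Lemma smooth_onP U u : smooth_on U u <-> forall N, smooth_upto N U u.
Proof.
split=> [uU N|uU s].
  elim: N u uU => [|N IHN] u uU; split=> //.
  - by move=> x; exact: smooth_on_continuous.
  - by move=> x; exact: smooth_on_continuous.
  - split=> [i x|i]; first exact: smooth_on_derivable.
    exact/IHN/smooth_on_pderiv.
(* The last index of [s] is the first derivative taken, so it is the one to be peeled off. *)
elim/last_ind: s u uU => [|s i IHs] u uU x Ux.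
  by have [uc [ud _]] := uU 1%N; split=> [|i]; [exact: uc|exact: ud].
rewrite /iter_pderiv foldr_rcons; apply: IHs => // N.
by have [_ [_]] := uU N.+1; exact.
Qed.

Lemma smooth_uptoW N U u : smooth_upto N.+1 U u -> smooth_upto N U u.
Proof.
elim: N u => [|N IHN] u [uc [ud du]]; split=> //; split=> // i.
exact/IHN/du.
Qed.

Lemma near_open U x (P : rV -> Prop) : open U -> U x ->
  (forall y, U y -> P y) -> \forall y \near x, P y.
Proof. by move=> Uo Ux UP; apply: filterS (open_nbhs_nbhs (conj Uo Ux)). Qed.

Lemma pderiv_eq_on U u v i x : open U -> (forall y, U y -> u y = v y) -> U x ->
  pderiv i u x = pderiv i v x.
Proof. by move=> Uo uv Ux; apply: near_eq_derive; exact: (@near_open _ _ (fun y => u y = v y) Uo Ux). Qed.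

Lemma continuous_eq_on U u v x : open U -> (forall y, U y -> u y = v y) -> U x ->
  {for x, continuous u} -> {for x, continuous v}.
Proof.
move=> Uo uv Ux; rewrite /prop_for /continuous_at -(uv x Ux) => uc.
have near_uv : nbhs x (fun y => u y = v y) by exact: near_open Ux uv.
move=> P /uc uP; have uP' : nbhs x (u @^-1` P) by exact: uP.
by apply: filterS (filterI uP' near_uv) => y /= [Py <-].
Qed.

(** Rules for [pderiv] are available only at points of [U]; openness lets a derivative be replaced
    by its formula there. *)
Lemma smooth_upto_eq N U u v : open U -> (forall y, U y -> u y = v y) ->
  smooth_upto N U u -> smooth_upto N U v.
Proof.
move=> Uo; elim: N u v => [|N IHN] u v uv [uc uN].
  by split=> // x Ux; exact: (continuous_eq_on Uo uv Ux (uc x Ux)).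
case: uN => ud uN; split; [|split].
- by move=> x Ux; exact: (continuous_eq_on Uo uv Ux (uc x Ux)).
- move=> i x Ux; apply: near_eq_derivable (ud i x Ux).
  exact: (@near_open _ _ (fun y => u y = v y) Uo Ux).
- move=> i; apply: IHN (uN i) => y Uy; exact: pderiv_eq_on Uo uv Uy.
Qed.

Lemma smooth_on_eq U u v : open U -> (forall y, U y -> u y = v y) ->
  smooth_on U u -> smooth_on U v.
Proof.
move=> Uo uv /smooth_onP uU; apply/smooth_onP => N.
exact: smooth_upto_eq uv (uU N).
Qed.

Lemma smooth_on_sub U V u : V `<=` U -> smooth_on U u -> smooth_on V u.
Proof. by move=> VU uU s x /VU; exact: uU. Qed.

Lemma smooth_upto_cst N U (a : R) : smooth_upto N U (cst a).
Proof.
elim: N a => [|N IHN] a; split=> //; do ?by move=> x _; exact: cst_continuous.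
split=> i; first by move=> x _; exact: derivable_cst.
rewrite (_ : pderiv i (cst a) = cst 0) //.
by apply/funext => x; rewrite /pderiv derive_cst.
Qed.

Lemma smooth_on_cst U (a : R) : smooth_on U (cst a).
Proof. by apply/smooth_onP => N; exact: smooth_upto_cst. Qed.

Lemma smooth_uptoD N U u v : open U ->
  smooth_upto N U u -> smooth_upto N U v -> smooth_upto N U (u + v).
Proof.
move=> Uo; elim: N u v => [|N IHN] u v [uc uN] [vc vN].
  by split=> // x Ux; apply: continuousD; [exact: uc|exact: vc].
case: uN vN => ud uN [vd vN]; split; [|split].
- by move=> x Ux; apply: continuousD; [exact: uc|exact: vc].
- by move=> i x Ux; apply: derivableD; [exact: ud|exact: vd].
- move=> i; apply: smooth_upto_eq (IHN _ _ (uN i) (vN i)) => // x Ux.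
  by rewrite /pderiv deriveD; [|exact: ud|exact: vd].
Qed.

Lemma smooth_on_add U u v : open U ->
  smooth_on U u -> smooth_on U v -> smooth_on U (u + v).
Proof.
by move=> Uo /smooth_onP uU /smooth_onP vU; apply/smooth_onP => N; exact: smooth_uptoD.
Qed.

Lemma smooth_uptoM N U u v : open U ->
  smooth_upto N U u -> smooth_upto N U v -> smooth_upto N U (u * v).
Proof.
move=> Uo; elim: N u v => [|N IHN] u v uU vU.
  by case: uU vU => uc _ [vc _]; split=> // x Ux;
    apply: continuousM; [exact: uc|exact: vc].
have [uc [ud uN]] := uU; have [vc [vd vN]] := vU; split; [|split].
- by move=> x Ux; apply: continuousM; [exact: uc|exact: vc].
- by move=> i x Ux; apply: derivableM; [exact: ud|exact: vd].
- move=> i; apply: smooth_upto_eq (smooth_uptoD Uo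
    (IHN _ _ (smooth_uptoW uU) (vN i)) (IHN _ _ (smooth_uptoW vU) (uN i))) => // x Ux.
  by rewrite /pderiv deriveM; [|exact: ud|exact: vd].
Qed.

Lemma smooth_on_mul U u v : open U ->
  smooth_on U u -> smooth_on U v -> smooth_on U (u * v).
Proof.
by move=> Uo /smooth_onP uU /smooth_onP vU; apply/smooth_onP => N; exact: smooth_uptoM.
Qed.

Lemma smooth_on_opp U u : open U -> smooth_on U u -> smooth_on U (- u).
Proof.
move=> Uo uU; rewrite -mulN1r; apply: smooth_on_mul => //.
rewrite (_ : - 1 = cst (- 1)) //; exact: smooth_on_cst.
Qed.

(** The derivative of 1/u is -u' times the square of 1/u, so order N for 1/u gives order N+1. *)
Lemma smooth_on_inv U u : open U -> (forall x, U x -> u x != 0) ->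
  smooth_on U u -> smooth_on U (fun x => (u x)^-1).
Proof.
move=> Uo u0 uU; apply/smooth_onP; elim=> [|N IHN].
  split=> // x Ux; apply: continuousV; first exact: u0.
  exact: smooth_on_continuous uU Ux.
split; [|split].
- move=> x Ux; apply: continuousV; first exact: u0.
  exact: smooth_on_continuous uU Ux.
- move=> i x Ux; apply: derivableV; first exact: u0.
  exact: smooth_on_derivable uU Ux.
- move=> i; have /smooth_onP/(_ N) dN := smooth_on_opp Uo (smooth_on_pderiv i uU).
  apply: smooth_upto_eq (smooth_uptoM Uo (smooth_uptoM Uo IHN IHN) dN) => // x Ux.
  rewrite /pderiv deriveV; [|exact: u0|exact: smooth_on_derivable uU Ux].
  by rewrite !fctE /GRing.scale /= mulrN mulNr -expr2 exprVn.
Qed.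

Lemma derivable_expR_comp u x i : differentiable u x ->
  derivable (fun y => expR (u y)) x 'e_i.
Proof.
move=> du; apply/diff_derivable.
have de : differentiable (@expR R) (u x) by apply/derivable1_diffP.
exact: (differentiable_comp du de).
Qed.

Lemma pderiv_expR_comp u x i : differentiable u x ->
  pderiv i (fun y => expR (u y)) x = expR (u x) * pderiv i u x.
Proof.
move=> du; have de : differentiable (@expR R) (u x) by apply/derivable1_diffP.
rewrite /pderiv (_ : (fun y => expR (u y)) = @expR R \o u) //.
rewrite deriveE; last exact: differentiable_comp.
rewrite diff_comp // deriv1E; last exact: derivable_expR.
by rewrite /= derive1E derive_val -deriveE // [LHS]mulrC.
Qed.

Lemma smooth_on_expR U u : open U -> smooth_on U u ->
  smooth_on U (fun x => expR (u x)).
Proof.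
move=> Uo uU.
have ud x : U x -> differentiable u x by exact: smooth_on_differentiable.
have cont x : U x -> {for x, continuous (fun x => expR (u x))}.
  move=> Ux; apply: continuous_comp; first exact: smooth_on_continuous uU Ux.
  exact: continuous_expR.
apply/smooth_onP; elim=> [|N IHN]; first by split.
split; [exact: cont|split].
- by move=> i x /ud; exact: derivable_expR_comp.
- move=> i; have /smooth_onP/(_ N) dN := smooth_on_pderiv i uU.
  apply: smooth_upto_eq (smooth_uptoM Uo IHN dN) => // x Ux.
  by rewrite pderiv_expR_comp; [|exact: ud].
Qed.

(** The induction is over all [u] at once, since the chain rule brings in the compositions of its
    partial derivatives with [F]. *)
Lemma smooth_on_comp U V u (F : rV -> rV) : open U -> open V ->
  smooth_map_on V F -> (forall x, V x -> U (F x)) -> smooth_on U u ->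
  smooth_on V (u \o F).
Proof.
move=> Uo Vo FV FVU uU; apply/smooth_onP => N.
have Fd x : V x -> forall a, differentiable (fun y => F y 0 a) x.
  by move=> Vx a; exact: smooth_on_differentiable (FV a) Vx.
have ud x : V x -> differentiable u (F x).
  by move=> Vx; exact: smooth_on_differentiable uU (FVU x Vx).
elim: N u uU ud => [|N IHN] u uU ud.
  split=> // x Vx; apply: differentiable_continuous.
  by apply: differentiable_comp; [exact/differentiable_rV/Fd|exact: ud].
split; [|split].
- move=> x Vx; apply: differentiable_continuous.
  by apply: differentiable_comp; [exact/differentiable_rV/Fd|exact: ud].
- move=> i x Vx; apply: diff_derivable.
  by apply: differentiable_comp; [exact/differentiable_rV/Fd|exact: ud].
- move=> i.
  have step : smooth_upto N V
      (\sum_a pderiv i (fun y => F y 0 a) * (pderiv a u \o F)).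
    elim/big_ind: _ => [||a _]; [exact: smooth_upto_cst| |].
      by move=> *; exact: smooth_uptoD.
    apply: smooth_uptoM => //.
      by have /smooth_onP := smooth_on_pderiv i (FV a); exact.
    apply: IHN; first exact: smooth_on_pderiv.
    move=> x Vx; exact: smooth_on_differentiable (smooth_on_pderiv a uU) (FVU x Vx).
  apply: smooth_upto_eq step => // x Vx.
  by rewrite pderiv_comp; [rewrite fct_sumE|exact: Fd|exact: ud].
Qed.

Lemma smooth_on_clairaut U u x i j : open U -> smooth_on U u -> U x ->
  pderiv i (pderiv j u) x = pderiv j (pderiv i u) x.
Proof.
move=> Uo uU Ux; apply: clairaut.
- apply: (near_open Uo Ux) => y Uy a; split; first exact: smooth_on_derivable uU Uy.
  move=> b; exact: smooth_on_derivable (smooth_on_pderiv a uU) Uy.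
- by apply: smooth_on_continuous Ux; do 2 apply: smooth_on_pderiv.
- by apply: smooth_on_continuous Ux; do 2 apply: smooth_on_pderiv.
Qed.

End SmoothClosure.

(** * The ring of smooth functions on an open set *)

(** The value at the base point is what functions take off the set in [smooth_pred]. As the point
    lies in the set, this value is determined by the restriction; unlike the value 0, it keeps the
    constant 1 in the ring. *)
Record open_domain (R : realType) (n : nat) := OpenDomain {
  dom_set : set 'rV[R]_n;
  dom_pt : 'rV[R]_n;
  dom_open : open dom_set;
  dom_ptP : dom_set dom_pt
}.

Section SmoothRing.
Variables (R : realType) (n : nat) (U : open_domain R n).
Local Notation rV := 'rV[R]_n.
Local Notation "''e_' i" := (delta_mx 0 i : rV) (at level 8, i at level 2).
Local Notation D := (dom_set U).
Local Notation pt := (dom_pt U).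
Let Do : open D := @dom_open R n U.
Let Dpt : D pt := dom_ptP U.

(* Smooth functions on an open set are represented by total functions that are
   constant off it, so that equality is equality on the open set. *)
Definition smooth_pred : {pred rV -> R} :=
  fun u => `[< smooth_on D u /\ forall x, ~ D x -> u x = u pt >].

Lemma smooth_predP u :
  reflect (smooth_on D u /\ forall x, ~ D x -> u x = u pt) (u \in smooth_pred).
Proof. exact: asboolP. Qed.

Lemma smooth_pred_subring : subring_closed smooth_pred.
Proof.
split.
- by apply/smooth_predP; split=> //; exact: smooth_on_cst.
- move=> u v /smooth_predP[uU u0] /smooth_predP[vU v0]; apply/smooth_predP.
  split; first by apply: smooth_on_add => //; exact: smooth_on_opp.
  by move=> x Dx; rewrite !fctE u0 ?v0.
- move=> u v /smooth_predP[uU u0] /smooth_predP[vU v0]; apply/smooth_predP.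
  split; first exact: smooth_on_mul.
  by move=> x Dx; rewrite !fctE u0 ?v0.
Qed.

HB.instance Definition _ :=
  GRing.isSubringClosed.Build (rV -> R) smooth_pred smooth_pred_subring.

Record smooth_fun := SmoothFun {
  sfun : rV -> R;
  sfun_in : sfun \in smooth_pred
}.

HB.instance Definition _ := [isSub for sfun].
HB.instance Definition _ := [Choice of smooth_fun by <:].
HB.instance Definition _ := [SubChoice_isSubComNzRing of smooth_fun by <:].

Implicit Types (a b : smooth_fun) (x : rV).

Lemma sfun_smooth a : smooth_on D (sfun a).
Proof. by have /smooth_predP[] := sfun_in a. Qed.

Lemma sfun_eq a b : (forall x, D x -> sfun a x = sfun b x) -> a = b.
Proof.
move=> ab; apply: val_inj; apply/funext => x /=.
have [/ab//|Dx] := pselect (D x).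
have /smooth_predP[_ ->//] := sfun_in a; have /smooth_predP[_ ->//] := sfun_in b.
exact: ab.
Qed.

(** With the point as first argument, evaluation at [x] can carry a ring morphism structure. *)
Definition seval x a : R := sfun a x.
#[global] Arguments seval : simpl never.

Lemma seval_is_zmod_morphism x : zmod_morphism (seval x).
Proof. by move=> a b; exact: (congr1 (@^~ x) (rmorphB (\val : smooth_fun -> rV -> R) a b)). Qed.

Lemma seval_is_monoid_morphism x : monoid_morphism (seval x).
Proof.
split=> [|a b]; first exact: (congr1 (@^~ x) (rmorph1 (\val : smooth_fun -> rV -> R))).
exact: (congr1 (@^~ x) (rmorphM (\val : smooth_fun -> rV -> R) a b)).
Qed.

HB.instance Definition _ x :=
  GRing.isZmodMorphism.Build smooth_fun R (seval x) (seval_is_zmod_morphism x).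
HB.instance Definition _ x :=
  GRing.isMonoidMorphism.Build smooth_fun R (seval x) (seval_is_monoid_morphism x).

Definition off_const (u : rV -> R) : rV -> R :=
  fun x => if `[< D x >] then u x else u pt.

Lemma off_constE u x : D x -> off_const u x = u x.
Proof. by move=> Dx; rewrite /off_const asboolT. Qed.

Lemma off_const_in u : smooth_on D u -> off_const u \in smooth_pred.
Proof.
move=> uU; apply/smooth_predP; split.
  by apply: smooth_on_eq uU => // x Dx; rewrite off_constE.
by move=> x Dx; rewrite [RHS]off_constE // /off_const asboolF.
Qed.

Definition mk_smooth u (uU : smooth_on D u) := SmoothFun (off_const_in uU).

Lemma mk_smoothE u (uU : smooth_on D u) x : D x -> seval x (mk_smooth uU) = u x.
Proof. exact: off_constE. Qed.

Definition sder i a : smooth_fun :=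
  mk_smooth (smooth_on_pderiv i (@sfun_smooth a)).

Lemma sderE i a u x : (forall y, D y -> seval y a = u y) -> D x ->
  seval x (sder i a) = pderiv i u x.
Proof. by move=> au Dx; rewrite mk_smoothE //; exact: pderiv_eq_on au Dx. Qed.

Lemma seval_sder i a x : D x -> seval x (sder i a) = pderiv i (sfun a) x.
Proof. exact: sderE. Qed.

Lemma sder_derivation i : derivation (sder i).
Proof.
split=> a b; apply: sfun_eq => x Dx; rewrite -[LHS]/(seval x _) -[RHS]/(seval x _).
  rewrite rmorphD /= !seval_sder //.
  rewrite (_ : sfun (a + b) = sfun a + sfun b); last first.
    by apply/funext => y; exact: (rmorphD (seval y)).
  rewrite /pderiv deriveD //.
  - exact: smooth_on_derivable (@sfun_smooth a) Dx.
  - exact: smooth_on_derivable (@sfun_smooth b) Dx.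
rewrite rmorphD !rmorphM /= !seval_sder //.
rewrite (_ : sfun (a * b) = sfun a * sfun b); last first.
  by apply/funext => y; exact: (rmorphM (seval y)).
rewrite /pderiv deriveM.
- by rewrite addrC; congr (_ + _); exact: mulrC.
- exact: smooth_on_derivable (@sfun_smooth a) Dx.
- exact: smooth_on_derivable (@sfun_smooth b) Dx.
Qed.

Lemma sder_comm i j a : sder i (sder j a) = sder j (sder i a).
Proof.
apply: sfun_eq => x Dx; rewrite -[LHS]/(seval x _) -[RHS]/(seval x _).
rewrite (sderE i (fun y Dy => seval_sder j a Dy) Dx).
rewrite (sderE j (fun y Dy => seval_sder i a Dy) Dx).
exact: smooth_on_clairaut Do (@sfun_smooth a) Dx.
Qed.

Definition shalf : smooth_fun := mk_smooth (@smooth_on_cst R n D 2^-1).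

Lemma seval_half x : D x -> seval x shalf = 2^-1.
Proof. exact: mk_smoothE. Qed.

Lemma shalfP : shalf + shalf = 1.
Proof.
apply: sfun_eq => x Dx; rewrite -[LHS]/(seval x _) -[RHS]/(seval x _).
by rewrite rmorphD rmorph1 /= seval_half // [RHS]splitr mul1r.
Qed.

End SmoothRing.

(** * Pullback of smooth functions along a smooth map *)

Section Pullback.
Variables (R : realType) (n : nat) (U V : open_domain R n).
Variable F : 'rV[R]_n -> 'rV[R]_n.
Hypothesis F_smooth : smooth_map_on (dom_set V) F.
Hypothesis F_dom : forall x, dom_set V x -> dom_set U (F x).

Let Uo : open (dom_set U) := @dom_open R n U.
Let Vo : open (dom_set V) := @dom_open R n V.

Definition pullback (a : smooth_fun U) : smooth_fun V :=
  mk_smooth (smooth_on_comp Uo Vo F_smooth F_dom (@sfun_smooth R n U a)).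

Lemma seval_pullback a x : dom_set V x -> seval x (pullback a) = seval (F x) a.
Proof. exact: mk_smoothE. Qed.

Lemma pullback_is_zmod_morphism : zmod_morphism pullback.
Proof.
move=> a b; apply: sfun_eq => x Vx; rewrite -[LHS]/(seval x _) -[RHS]/(seval x _).
by rewrite rmorphB /= !seval_pullback // rmorphB.
Qed.

Lemma pullback_is_monoid_morphism : monoid_morphism pullback.
Proof.
split=> [|a b]; apply: sfun_eq => x Vx;
  rewrite -[LHS]/(seval x _) -[RHS]/(seval x _).
  by rewrite seval_pullback // !rmorph1.
by rewrite rmorphM /= !seval_pullback // rmorphM.
Qed.

HB.instance Definition _ := GRing.isZmodMorphism.Build
  (smooth_fun U) (smooth_fun V) pullback pullback_is_zmod_morphism.
HB.instance Definition _ := GRing.isMonoidMorphism.Build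
  (smooth_fun U) (smooth_fun V) pullback pullback_is_monoid_morphism.

Lemma F_differentiable x : dom_set V x ->
  forall a, differentiable (fun y => F y 0 a) x.
Proof. by move=> Vx a; exact: smooth_on_differentiable Vo (F_smooth a) Vx. Qed.

Lemma sder_pullback i a x : dom_set V x ->
  seval x (sder i (pullback a)) =
  \sum_b pderiv i (fun y => F y 0 b) x * seval (F x) (sder b a).
Proof.
move=> Vx; rewrite (sderE i (fun y Vy => seval_pullback a Vy) Vx).
rewrite -[X in pderiv i X](_ : sfun a \o F = _) // pderiv_comp.
- by apply: eq_bigr => b _; rewrite seval_sder //; exact: F_dom.
- exact: F_differentiable.
- exact: smooth_on_differentiable Uo (@sfun_smooth _ _ _ a) (F_dom Vx).
Qed.

End Pullback.

(** * The local geometry computed in the ring of smooth functions *)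

Section EvalMatrix.
Variables (R : realType) (n : nat) (U : open_domain R n).

Lemma smx_eq m p (M N : 'M[smooth_fun U]_(m, p)) :
  (forall x, dom_set U x -> map_mx (seval x) M = map_mx (seval x) N) -> M = N.
Proof.
move=> MN; apply/matrixP=> i j; apply: sfun_eq => x Ux.
by have /matrixP/(_ i j) := MN x Ux; rewrite !mxE.
Qed.

Variable G : 'rV[R]_n -> 'M[R]_n.
Hypothesis G_smooth : forall i j, smooth_on (dom_set U) (fun x => G x i j).
Hypothesis G_unit : forall x, dom_set U x -> G x \in unitmx.
Let Uo : open (dom_set U) := @dom_open R n U.

Definition mk_mx : 'M[smooth_fun U]_n := \matrix_(i, j) mk_smooth (G_smooth i j).

Lemma map_mk_mx x : dom_set U x -> map_mx (seval x) mk_mx = G x.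
Proof. by move=> Ux; apply/matrixP=> i j; rewrite !mxE mk_smoothE. Qed.

(** Cramer's rule: the determinant and the adjugate, formed in the ring of smooth functions, are
    smooth by construction. *)
Lemma invmx_smooth i j : smooth_on (dom_set U) (fun x => invmx (G x) i j).
Proof.
have detE x : dom_set U x -> seval x (\det mk_mx) = \det (G x).
  by move=> Ux; rewrite -det_map_mx map_mk_mx.
have adjE x : dom_set U x -> seval x ((\adj mk_mx) i j) = (\adj (G x)) i j.
  by move=> Ux; rewrite -(map_mk_mx Ux) -map_mx_adj [RHS]mxE.
have det0 x : dom_set U x -> sfun (\det mk_mx) x != 0.
  by move=> Ux; rewrite -/(seval x _) detE // -unitfE; exact: G_unit.
apply: (smooth_on_eq Uo _ (smooth_on_mul Uo
  (smooth_on_inv Uo det0 (@sfun_smooth _ _ _ _))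
  (@sfun_smooth _ _ _ ((\adj mk_mx) i j)))) => x Ux.
rewrite fctE -!/(seval x _) detE // adjE // /invmx.
by rewrite G_unit // [RHS]mxE.
Qed.

Definition mk_invmx : 'M[smooth_fun U]_n :=
  \matrix_(i, j) mk_smooth (invmx_smooth i j).

Lemma map_mk_invmx x : dom_set U x -> map_mx (seval x) mk_invmx = invmx (G x).
Proof. by move=> Ux; apply/matrixP=> i j; rewrite !mxE mk_smoothE. Qed.

Lemma mk_mxV : mk_mx *m mk_invmx = 1%:M.
Proof.
apply: smx_eq => x Ux.
by rewrite map_mxM map_mk_mx // map_mk_invmx // map_mx1 mulmxV // G_unit.
Qed.

Lemma mk_mx_sym : (forall x, dom_set U x -> (G x)^T = G x) -> mk_mx^T = mk_mx.
Proof. by move=> Gs; apply: smx_eq => x Ux; rewrite -map_trmx map_mk_mx // Gs. Qed.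

Local Notation g := mk_mx.
Local Notation h := mk_invmx.
Local Notation half := (shalf U).
Local Notation d := (@sder R n U).

Let gE i j x : dom_set U x -> seval x (g i j) = G x i j.
Proof. by move=> Ux; rewrite mxE mk_smoothE. Qed.

Let hE i j x : dom_set U x -> seval x (h i j) = metric_inv G x i j.
Proof. by move=> Ux; rewrite mxE mk_smoothE. Qed.

Let dgE k i j x : dom_set U x ->
  seval x (d k (g i j)) = pderiv k (fun y => G y i j) x.
Proof. by move=> Ux; exact: (sderE _ (fun y => @gE i j y) Ux). Qed.

Lemma seval_chr k i j x : dom_set U x ->
  seval x (chr half d g h k i j) = christoffel G k i j x.
Proof.
move=> Ux; rewrite rmorphM rmorph_sum /= seval_half //; congr (_ * _).
apply: eq_bigr => m _; rewrite rmorphM rmorphB rmorphD /=.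
by rewrite hE // !dgE.
Qed.

Lemma seval_rm13 i j k l x : dom_set U x ->
  seval x (rm13 half d g h i j k l) = riem13 G i j k l x.
Proof.
move=> Ux; rewrite rmorphD rmorphB rmorph_sum /=; congr (_ - _ + _).
- exact: (sderE _ (fun y => @seval_chr i l j y) Ux).
- exact: (sderE _ (fun y => @seval_chr i k j y) Ux).
- apply: eq_bigr => m _; rewrite rmorphB; congr (_ - _); rewrite [LHS]rmorphM /=;
  by rewrite !seval_chr.
Qed.

Lemma seval_rm04 i j k l x : dom_set U x ->
  seval x (rm04 half d g h i j k l) = riem G i j k l x.
Proof.
move=> Ux; rewrite rmorph_sum; apply: eq_bigr => m _.
by rewrite rmorphM /= gE // seval_rm13.
Qed.

Lemma seval_ric j l x : dom_set U x ->
  seval x (ric half d g h j l) = ricci G j l x.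
Proof.
move=> Ux; rewrite rmorph_sum; apply: eq_bigr => i _; rewrite rmorph_sum.
by apply: eq_bigr => k _; rewrite rmorphM /= hE // seval_rm04.
Qed.

Variables (f : 'rV[R]_n -> R).
Hypothesis f_smooth : smooth_on (dom_set U) f.
Local Notation fA := (mk_smooth f_smooth).

Lemma seval_hes i j x : dom_set U x ->
  seval x (hes half d g h fA i j) = hess G f i j x.
Proof.
have fE k y : dom_set U y -> seval y (d k fA) = pderiv k f y.
  by move=> Uy; apply: sderE => // z Uz; rewrite mk_smoothE.
move=> Ux; rewrite rmorphB rmorph_sum /=; congr (_ - _).
  exact: (sderE _ (fun y => @fE j y) Ux).
by apply: eq_bigr => k _; rewrite rmorphM /= fE // seval_chr.
Qed.

Lemma seval_soliton_mx x : dom_set U x ->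
  map_mx (seval x) (soliton_mx half d g h fA) =
  \matrix_(i, j) (ricci G i j x + hess G f i j x).
Proof.
by move=> Ux; apply/matrixP=> i j; rewrite !mxE rmorphD /= seval_ric // seval_hes.
Qed.

Lemma exp_opp_smooth : smooth_on (dom_set U) (fun x => expR (- f x)).
Proof. exact: smooth_on_expR Uo (smooth_on_opp Uo f_smooth). Qed.
Local Notation eA := (mk_smooth exp_opp_smooth).

Lemma sder_exp_opp i : d i eA = - d i fA * eA.
Proof.
apply: sfun_eq => x Ux; rewrite -[LHS]/(seval x _) -[RHS]/(seval x _).
have nf := smooth_on_opp Uo f_smooth.
rewrite rmorphM rmorphN /= (sderE _ (fun y => @mk_smoothE _ _ _ _ exp_opp_smooth y)) //.
rewrite (sderE _ (fun y => @mk_smoothE _ _ _ _ f_smooth y)) // mk_smoothE //.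
rewrite (pderiv_expR_comp i (u := - f)); last first.
  exact: smooth_on_differentiable nf Ux.
rewrite mulrC; congr (_ * _); rewrite /pderiv deriveN //.
exact: smooth_on_derivable f_smooth Ux.
Qed.

Lemma seval_dv4 j k l x : dom_set U x ->
  seval x (dv4 half d g h (fun i j k l => eA * rm04 half d g h i j k l) j k l)
  = div4 G (weighted_riem G f) j k l x.
Proof.
have WE a b c e y : dom_set U y ->
    seval y (eA * rm04 half d g h a b c e) = weighted_riem G f a b c e y.
  by move=> Uy; rewrite rmorphM /= mk_smoothE // seval_rm04.
move=> Ux; rewrite rmorph_sum; apply: eq_bigr => m _; rewrite rmorph_sum.
apply: eq_bigr => i _; rewrite rmorphM /= hE //; congr (_ * _).
rewrite rmorphB rmorph_sum /=; congr (_ - _).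
  exact: (sderE _ (fun y => @WE i j k l y) Ux).
apply: eq_bigr => a _; rewrite !rmorphD /=; congr (_ + _ + _ + _);
  by rewrite [LHS]rmorphM /= seval_chr // WE.
Qed.

End EvalMatrix.

(** * The maximum principle in a chart *)

Section LocalArgument.
Variables (R : realType) (n : nat) (U : open_domain R n).
Variables (G : 'rV[R]_n -> 'M[R]_n) (f : 'rV[R]_n -> R) (lambda : R).
Hypothesis G_smooth : forall i j, smooth_on (dom_set U) (fun x => G x i j).
Hypothesis G_sym : forall x, dom_set U x -> (G x)^T = G x.
Hypothesis G_posdef : forall x, dom_set U x -> posdef (G x).
Hypothesis f_smooth : smooth_on (dom_set U) f.

Let Uo : open (dom_set U) := @dom_open R n U.
Let G_unit x (Ux : dom_set U x) : G x \in unitmx := posdef_unitmx (G_posdef Ux).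

Local Notation g := (mk_mx G_smooth).
Local Notation h := (mk_invmx G_smooth G_unit).
Local Notation half := (shalf U).
Local Notation d := (@sder R n U).
Local Notation fA := (mk_smooth f_smooth).
Local Notation eA := (mk_smooth (exp_opp_smooth f_smooth)).
Local Notation C := (conn half d g h).
Local Notation D := (nab2 d C).
Local Notation T := (soliton_mx half d g h fA).

Definition soliton_tensor x : 'M[R]_n := \matrix_(i, j) (ricci G i j x + hess G f i j x).

Definition soliton_defect x : 'M[R]_n := soliton_tensor x - lambda *: G x.

(** The squared norm |S|^2, as the trace of the square of the endomorphism S g^-1: no frame is
    involved, so smoothness and independence of the chart can be read off. *)
Definition defect_sqnorm x : R :=
  \tr (soliton_defect x *m invmx (G x) *m (soliton_defect x *m invmx (G x))).

Let gh : g *m h = 1%:M := mk_mxV G_smooth G_unit.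
Let g_sym : g^T = g := mk_mx_sym G_smooth G_sym.
Let halfP : half + half = 1 := shalfP U.
Let dder := @sder_derivation R n U.
Let dcomm := @sder_comm R n U.

Lemma div4_weighted_riem j k l x : dom_set U x ->
  div4 G (weighted_riem G f) j k l x =
  expR (- f x) * seval x (D k T j l - D l T j k).
Proof.
move=> Ux; rewrite -(seval_dv4 G_smooth G_unit f_smooth j k l Ux).
rewrite (dv4_weighted halfP dder g_sym gh dcomm j k l (sder_exp_opp f_smooth)).
by rewrite rmorphM /= mk_smoothE.
Qed.

Let lamA : smooth_fun U := mk_smooth (@smooth_on_cst R n (dom_set U) lambda).
Let sder_lam i : d i lamA = 0.
Proof.
apply: sfun_eq => x Ux; rewrite -[LHS]/(seval x _) -[RHS]/(seval x _).
rewrite rmorph0 (sderE i (fun y => @mk_smoothE _ _ _ _ _ y) Ux).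
by rewrite /pderiv derive_cst.
Qed.

Let nab2_lam k : D k (lamA *: g) = 0.
Proof.
have e := nab2_metric d halfP g_sym gh k.
rewrite /nab2 (map_derZ (dder k)) sder_lam scale0r add0r -scalemxAr -scalemxAl.
by rewrite -!scalerBr -/(nab2 d C k g) e scaler0.
Qed.

Let S : 'M[smooth_fun U]_n := T - lamA *: g.

Let map_T x : dom_set U x -> map_mx (seval x) T = soliton_tensor x.
Proof. exact: seval_soliton_mx. Qed.

Let map_lamg x : dom_set U x -> map_mx (seval x) (lamA *: g) = lambda *: G x.
Proof. by move=> Ux; rewrite map_mxZ /= mk_smoothE // map_mk_mx. Qed.

Let map_S x : dom_set U x -> map_mx (seval x) S = soliton_defect x.
Proof. by move=> Ux; rewrite map_mxB map_T // map_lamg. Qed.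

Lemma soliton_div_free : (forall x, dom_set U x -> soliton_defect x = 0) ->
  forall x, dom_set U x -> forall j k l, div4 G (weighted_riem G f) j k l x = 0.
Proof.
move=> sol x Ux j k l; rewrite div4_weighted_riem //.
have -> : T = lamA *: g.
  apply/eqP; rewrite -subr_eq0; apply/eqP; apply: smx_eq => y Uy.
  by rewrite map_S // sol // map_mx0.
by rewrite !nab2_lam !mxE subrr rmorph0 mulr0.
Qed.

Lemma soliton_tensor_trace x : dom_set U x ->
  scalar_curv G x + laplacian G f x = \tr (soliton_tensor x *m invmx (G x)).
Proof.
move=> Ux; rewrite -big_split; apply: eq_bigr => i _ /=.
rewrite -big_split [RHS]mxE; apply: eq_bigr => j _ /=.
have -> : invmx (G x) j i = metric_inv G x i j.
  by rewrite /metric_inv -{2}(G_sym Ux) -trmx_inv mxE.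
by rewrite mxE -mulrDr mulrC.
Qed.

Lemma soliton_trace x : dom_set U x -> soliton_defect x = 0 ->
  scalar_curv G x + laplacian G f x = n%:R * lambda.
Proof.
move=> Ux /subr0_eq e; rewrite soliton_tensor_trace // e -scalemxAl.
by rewrite mulmxV ?G_unit // mxtraceZ mxtrace1 mulrC.
Qed.

Lemma defect_sqnorm_smooth : smooth_on (dom_set U) defect_sqnorm.
Proof.
apply: (smooth_on_eq Uo _ (@sfun_smooth _ _ _ (\tr (S *m h *m (S *m h))))) => x Ux.
rewrite -/(seval x _) -trace_map_mx !map_mxM map_S //.
by rewrite map_mk_invmx.
Qed.

Let defect_sym x : dom_set U x -> (soliton_defect x)^T = soliton_defect x.
Proof.
move=> Ux; rewrite -map_S // map_trmx; congr (map_mx _ _).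
rewrite (raddfB (@trmx _ n n)) /= linearZ /= g_sym.
by rewrite (soliton_mx_sym halfP dder g_sym gh dcomm).
Qed.

Lemma defect_sqnorm_ge0 x : dom_set U x -> 0 <= defect_sqnorm x.
Proof.
(* Diagonalizing the metric against itself only serves to produce an orthonormal frame. *)
move=> Ux; have [E [EgE _]] := simultaneous_diag (G_posdef Ux) (G_sym Ux) (G_sym Ux).
have GV : G x *m invmx (G x) = 1%:M by rewrite mulmxV ?G_unit.
exact: (sqnorm_ge0 GV EgE (defect_sym Ux)).
Qed.

Lemma defect_sqnorm_eq0 x : dom_set U x -> defect_sqnorm x = 0 ->
  soliton_defect x = 0.
Proof.
move=> Ux; have [E [EgE _]] := simultaneous_diag (G_posdef Ux) (G_sym Ux) (G_sym Ux).
have GV : G x *m invmx (G x) = 1%:M by rewrite mulmxV ?G_unit.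
exact: (sqnorm_eq0 GV EgE (defect_sym Ux)).
Qed.

Hypothesis div_free : forall x, dom_set U x -> forall j k l,
  div4 G (weighted_riem G f) j k l x = 0.
Hypothesis trace_eq : forall x, dom_set U x ->
  scalar_curv G x + laplacian G f x = n%:R * lambda.
Hypothesis sec_pos : forall x, dom_set U x -> forall u v : 'rV[R]_n,
  row_free (col_mx u v) -> 0 < sectional G x u v.

Let S_sym : S^T = S.
Proof. by apply: smx_eq => x Ux; rewrite -map_trmx map_S // defect_sym. Qed.

Let nab2_S k : D k S = D k T.
Proof.
rewrite -[in RHS](subrK (lamA *: g) T) -/S.
by rewrite [RHS](nab2D half g h dder) nab2_lam addr0.
Qed.

Let S_codazzi j k l : D k S j l = D l S j k.
Proof.
rewrite !nab2_S; apply: sfun_eq => x Ux; rewrite -[LHS]/(seval x _) -[RHS]/(seval x _).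
have /eqP := div_free Ux j k l; rewrite div4_weighted_riem // mulf_eq0.
by rewrite gt_eqF ?expR_gt0 //= rmorphB subr_eq0 => /eqP.
Qed.

Let S_trace0 x : dom_set U x -> \tr (soliton_defect x *m invmx (G x)) = 0.
Proof.
move=> Ux; rewrite mulmxBl raddfB /= -soliton_tensor_trace // trace_eq //.
by rewrite -scalemxAl mulmxV ?G_unit // mxtraceZ mxtrace1 mulrC subrr.
Qed.

Let S_trace k : d k (\tr (S *m h)) = 0.
Proof.
have -> : \tr (S *m h) = 0.
  apply: sfun_eq => x Ux; rewrite -[LHS]/(seval x _) -[RHS]/(seval x _).
  by rewrite rmorph0 -trace_map_mx map_mxM map_S // map_mk_invmx // S_trace0.
exact: der0 (dder k).
Qed.

(** Simons' identity is evaluated at [x], in an orthonormal eigenframe of that single point. It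
    bounds the curvature term above by zero, [curv_act_pos] bounds it below, and the equality case
    gives the claim. *)
Lemma defect_at_max x : dom_set U x ->
  (forall y, dom_set U y -> defect_sqnorm y <= defect_sqnorm x) ->
  soliton_defect x = 0.
Proof.
move=> Ux xmax.
pose phiA := \tr (S *m h *m (S *m h)).
have phiE y : dom_set U y -> seval y phiA = defect_sqnorm y.
  by move=> Uy; rewrite -trace_map_mx !map_mxM map_S // map_mk_invmx.
have phi_smooth := @sfun_smooth _ _ _ phiA.
have phi_max y : dom_set U y -> sfun phiA y <= sfun phiA x.
  by move=> Uy; rewrite -!/(seval _ _) !phiE // xmax.
have grad0 a : seval x (d a phiA) = 0.
  rewrite seval_sder //; apply: (gradient_at_max Uo Ux) phi_max a => i y Uy.
  exact: smooth_on_derivable phi_smooth Uy.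
have [E [EgE ES]] := simultaneous_diag (G_posdef Ux) (G_sym Ux) (defect_sym Ux).
have GV : G x *m invmx (G x) = 1%:M by rewrite mulmxV ?G_unit.
have hE := frame_inv GV EgE.
pose H := invmx (G x).
have map_h : map_mx (seval x) h = H by exact: map_mk_invmx.
have map_hE k l : seval x (h k l) = H k l by rewrite -map_h [RHS]mxE.
have map_g : map_mx (seval x) g = G x by exact: map_mk_mx.
pose F l i := map_mx (seval x) (curv d C l i).
pose B k := map_mx (seval x) (D k S).
have B_sym k : (B k)^T = B k by rewrite map_trmx (nab2_sym half d g h k S_sym).
have F_anti k l : F l k = - F k l by rewrite /F curvN map_mxN.
have Fg_anti k l : (F k l *m G x)^T = - (F k l *m G x).
  rewrite -map_g -map_mxM map_trmx.
  by rewrite (curv_g_antisym halfP dder g_sym gh dcomm) map_mxN.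
have K_gt0 (u v : 'rV[R]_n) : row_free (col_mx u v) ->
    (u *m G x *m u^T) 0 0 = 1 -> (v *m G x *m v^T) 0 0 = 1 ->
    (u *m G x *m v^T) 0 0 = 0 ->
    0 < \sum_i \sum_j \sum_k \sum_l
      (F k l *m G x) j i * u 0 i * v 0 j * u 0 k * v 0 l.
  move=> uv uu vv u_v; have := sec_pos Ux uv.
  rewrite /sectional /metric_dot uu vv u_v mulr1 expr2 mulr0 subr0 divr1.
  have riemE i j k l : riem G i j k l x = (F k l *m G x) j i.
    rewrite -(seval_rm04 G_smooth G_unit i j k l Ux) (rm04E half d h g_sym).
    by rewrite -map_g -map_mxM [RHS]mxE.
  congr (is_true (0 < _)); apply: eq_bigr => i _; apply: eq_bigr => j _.
  by apply: eq_bigr => k _; apply: eq_bigr => l _; rewrite riemE.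
have [Qge0 Qeq0] := curv_act_pos (G_sym Ux) GV EgE ES F_anti Fg_anti K_gt0
  (defect_sym Ux) (S_trace0 Ux).
apply: Qeq0; apply/eqP; rewrite eq_le {}Qge0 andbT.
have := congr1 (seval x) (simons halfP dder g_sym gh dcomm S_sym S_codazzi S_trace).
(* Writing the inverse metric as E^T E turns the contracted coordinate Hessian into a sum of second
   derivatives along the frame vectors, each nonpositive at a maximum. *)
have -> : seval x (\sum_k \sum_l h k l * d l (d k phiA)) =
    \sum_a \sum_k \sum_l (row a E) 0 k * (row a E) 0 l * pderiv l (pderiv k (sfun phiA)) x.
  rewrite rmorph_sum [RHS]exchange_big; apply: eq_bigr => k _.
  rewrite rmorph_sum [RHS]exchange_big; apply: eq_bigr => l _ /=.
  rewrite rmorphM /= map_hE /H hE mxE big_distrl; apply: eq_bigr => a _ /=.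
  by rewrite !mxE (sderE l (fun y => @seval_sder _ _ _ k phiA y) Ux).
have trE X Y : seval x (\tr (X *m h *m (Y *m h))) =
    \tr (map_mx (seval x) X *m H *m (map_mx (seval x) Y *m H)).
  by rewrite -trace_map_mx !map_mxM map_h.
rewrite rmorphD rmorphMn rmorphD /=.
(* The Christoffel part of the Laplacian carries the gradient, which vanishes at [x]. *)
have -> : seval x (\sum_k \sum_l h k l *
    \sum_a chr half d g h a l k * d a (\tr (S *m h *m (S *m h)))) = 0.
  rewrite rmorph_sum big1 // => k _; rewrite rmorph_sum big1 // => l _.
  rewrite rmorphM rmorph_sum big1 ?mulr0 // => a _.
  by rewrite rmorphM /= grad0 mulr0.
have -> : seval x (\sum_k \sum_l h k l * \tr (D k S *m h *m (D l S *m h))) =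
    \sum_k \sum_l H k l * \tr (B k *m H *m (B l *m H)).
  rewrite rmorph_sum; apply: eq_bigr => k _; rewrite rmorph_sum.
  by apply: eq_bigr => l _; rewrite rmorphM /= map_hE trE.
have -> : seval x (\tr (curv_act half d g h S *m h *m (S *m h))) =
    \tr ((\matrix_(i, j) - \sum_k \sum_l H k l *
      (F l i *m soliton_defect x + soliton_defect x *m (F l i)^T) k j) *m H
      *m (soliton_defect x *m H)).
  rewrite trE map_S //; congr (\tr (_ *m _ *m _)).
  apply/matrixP=> i j; rewrite [LHS]mxE [curv_act _ _ _ _ _ i j]mxE [RHS]mxE.
  rewrite rmorphN rmorph_sum; congr (- _); apply: eq_bigr => k _.
  rewrite rmorph_sum; apply: eq_bigr => l _; rewrite rmorphM /= map_hE.
  congr (_ * _); rewrite /F map_trmx -map_S // -!map_mxM -map_mxD.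
  by rewrite [RHS]mxE.
rewrite add0r => e.
have lhs_le0 : \sum_a \sum_k \sum_l row a E 0 k * row a E 0 l *
    pderiv l (pderiv k (sfun phiA)) x <= 0.
  apply: sumr_le0 => a _; exact: (hessian_at_max _ Uo phi_smooth Ux phi_max).
have B_ge0 := sqnorm_contract_ge0 GV EgE B_sym.
move: e lhs_le0 B_ge0 => ->; rewrite -/H; set b := \sum_k _; set q := \tr _.
by rewrite pmulrn_lle0 // => bq b0; rewrite (le_trans _ bq) // lerDr.
Qed.

End LocalArgument.

(** * Change of chart *)

Lemma mxtrace_congr (R : comNzRingType) n (J K S H H' : 'M[R]_n) :
  K *m J = 1%:M -> J^T *m H = H' *m K ->
  \tr (J *m S *m J^T *m H *m (J *m S *m J^T *m H)) = \tr (S *m H' *m (S *m H')).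
Proof.
move=> KJ JH; rewrite -!(mulmxA (J *m S)) JH !mulmxA mxtrace_mulC !mulmxA.
by rewrite KJ mul1mx -(mulmxA _ K J) KJ mulmx1.
Qed.

Section Overlap.
Variables (R : realType) (n : nat) (U V : open_domain R n).
Variables (G G' : 'rV[R]_n -> 'M[R]_n) (f f' : 'rV[R]_n -> R).
Variable F : 'rV[R]_n -> 'rV[R]_n.
Hypothesis F_smooth : smooth_map_on (dom_set V) F.
Hypothesis F_dom : forall x, dom_set V x -> dom_set U (F x).
Hypothesis G_smooth : forall i j, smooth_on (dom_set V) (fun x => G x i j).
Hypothesis G_sym : forall x, dom_set V x -> (G x)^T = G x.
Hypothesis G_unit : forall x, dom_set V x -> G x \in unitmx.
Hypothesis f_smooth : smooth_on (dom_set V) f.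
Hypothesis G'_smooth : forall i j, smooth_on (dom_set U) (fun x => G' x i j).
Hypothesis G'_sym : forall x, dom_set U x -> (G' x)^T = G' x.
Hypothesis G'_unit : forall x, dom_set U x -> G' x \in unitmx.
Hypothesis f'_smooth : smooth_on (dom_set U) f'.
Hypothesis fE : forall x, dom_set V x -> f x = f' (F x).
Hypothesis GE : forall x, dom_set V x ->
  G x = 'J F x *m G' (F x) *m ('J F x)^T.

Local Notation g := (mk_mx G_smooth).
Local Notation h := (mk_invmx G_smooth G_unit).
Local Notation fA := (mk_smooth f_smooth).
Local Notation d := (@sder R n V).
Local Notation pull := (pullback F_smooth F_dom).
Local Notation g' := (map_mx pull (mk_mx G'_smooth)).
Local Notation h' := (map_mx pull (mk_invmx G'_smooth G'_unit)).

Let y a : smooth_fun V := mk_smooth (F_smooth a).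
Let J : 'M[smooth_fun V]_n := \matrix_(i, a) d i (y a).
(** The inverse Jacobian matrix, read off from g = J g' J^T instead of from the inverse transition
    map. *)
Let K : 'M[smooth_fun V]_n := g' *m J^T *m h.
(** The coordinate derivations of the second chart, expressed on functions of the coordinates of the
    first; [pull_d] confirms that they are the pulled-back ones. *)
Let d' a v := \sum_i K a i * d i v.

Let map_J x : dom_set V x -> map_mx (seval x) J = 'J F x.
Proof.
move=> Vx; apply/matrixP=> i a; rewrite [LHS]mxE [J i a]mxE.
rewrite (sderE i (fun z => @mk_smoothE _ _ _ _ (F_smooth a) z) Vx) jacobianE //.
exact: (F_differentiable F_smooth Vx).
Qed.

Let map_pull m p (M : 'M[smooth_fun U]_(m, p)) x : dom_set V x ->
  map_mx (seval x) (map_mx pull M) = map_mx (seval (F x)) M.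
Proof.
by move=> Vx; apply/matrixP=> i j; rewrite !mxE; exact: seval_pullback.
Qed.

Let g_frame : g = J *m g' *m J^T.
Proof.
apply: smx_eq => x Vx; have Ux := F_dom Vx.
by rewrite map_mk_mx // GE // !map_mxM map_pull // map_mk_mx // -map_trmx map_J.
Qed.

Let JK : J *m K = 1%:M.
Proof. by rewrite /K !mulmxA -g_frame mk_mxV. Qed.

Let dE i v : d i v = \sum_a J i a * d' a v.
Proof.
rewrite /d'; under [RHS]eq_bigr => a _ do rewrite big_distrr /=.
rewrite exchange_big /= (eq_bigr (fun k => (J *m K) i k * d k v)).
  rewrite JK (bigD1 i) //= big1 => [|b /negbTE ab].
    by rewrite mxE eqxx mul1r addr0.
  by rewrite mxE eq_sym ab mul0r.
by move=> b _; rewrite mxE big_distrl; apply: eq_bigr => a _; rewrite mulrA.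
Qed.

(** The chain rule expresses the derivatives of a pullback through [J]; multiplying by [K] inverts
    it. *)
Let pull_d a u : pull (sder a u) = d' a (pull u).
Proof.
have KJ : K *m J = 1%:M by exact: mulmx1C.
have dp i : d i (pull u) = \sum_b J i b * pull (sder b u).
  apply: sfun_eq => x Vx; rewrite -[LHS]/(seval x _) -[RHS]/(seval x _).
  rewrite sder_pullback // rmorph_sum; apply: eq_bigr => b _.
  rewrite rmorphM /= seval_pullback //; congr (_ * _).
  by rewrite mxE (sderE i (fun z => @mk_smoothE _ _ _ _ (F_smooth b) z) Vx).
rewrite /d'; under eq_bigr => i _ do rewrite dp big_distrr /=.
rewrite exchange_big /= (eq_bigr (fun b => (K *m J) a b * pull (sder b u))).
  rewrite KJ (bigD1 a) //= big1 => [|b /negbTE ab].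
    by rewrite mxE eqxx mul1r addr0.
  by rewrite mxE eq_sym ab mul0r.
by move=> b _; rewrite mxE big_distrl; apply: eq_bigr => i _; rewrite mulrA.
Qed.

Lemma soliton_tensor_transition x : dom_set V x ->
  soliton_tensor G f x =
  'J F x *m soliton_tensor G' f' (F x) *m ('J F x)^T.
Proof.
move=> Vx; have Ux := F_dom Vx.
have g'_sym : g'^T = g' by rewrite map_trmx (mk_mx_sym G'_smooth G'_sym).
have gh' : g' *m h' = 1%:M by rewrite -map_mxM mk_mxV map_mx1.
have half_pull : pull (shalf U) = shalf V.
  apply: sfun_eq => z Vz; rewrite -[LHS]/(seval z _) -[RHS]/(seval z _).
  have Uz := F_dom Vz.
  by rewrite seval_pullback // !seval_half.
have f_pull : pull (mk_smooth f'_smooth) = fA.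
  apply: sfun_eq => z Vz; rewrite -[LHS]/(seval z _) -[RHS]/(seval z _).
  have Uz := F_dom Vz.
  by rewrite seval_pullback // !mk_smoothE // fE.
have := soliton_mx_frame (shalfP V) (@sder_derivation R n V) (@sder_comm R n V)
  (mk_mx_sym G_smooth G_sym) (mk_mxV G_smooth G_unit) g'_sym gh' JK
  (fun i a => mxE _ _ i a) dE g_frame fA.
rewrite -{2}half_pull -{2}f_pull -(soliton_mx_morph _ _ _ pull_d).
move/(congr1 (map_mx (seval x))); rewrite seval_soliton_mx // -/(soliton_tensor G f x) => ->.
by rewrite !map_mxM map_pull // seval_soliton_mx // -map_trmx map_J.
Qed.

Lemma defect_sqnorm_transition lambda x : dom_set V x ->
  defect_sqnorm G f lambda x = defect_sqnorm G' f' lambda (F x).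
Proof.
move=> Vx; have Ux := F_dom Vx; rewrite /defect_sqnorm.
set S := soliton_defect G f lambda x; set S' := soliton_defect G' f' lambda (F x).
pose Jx := 'J F x; pose Kx := G' (F x) *m Jx^T *m invmx (G x).
have JKx : Jx *m Kx = 1%:M.
  by rewrite /Kx !mulmxA -GE // mulmxV ?G_unit.
have KJx := mulmx1C JKx.
have SE : S = Jx *m S' *m Jx^T.
  rewrite /S /S' /soliton_defect soliton_tensor_transition // mulmxBr mulmxBl.
  by rewrite {1}GE // -scalemxAr -scalemxAl.
have inv : Jx^T *m invmx (G x) = invmx (G' (F x)) *m Kx.
  by rewrite /Kx !mulmxA mulVmx ?G'_unit // mul1mx.
by rewrite SE; exact: (mxtrace_congr S' KJx inv).
Qed.

End Overlap.

(** * The global argument *)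

Section Charts.
Variables (R : realType) (n : nat) (M : topologicalType).
Variables (A : smooth_manifold R n M) (g : riemannian_metric A) (f : M -> R).
Hypothesis f_smooth : smooth_function A f.

(** Any point of the chart image serves as base point. *)
Definition chart_domain (c : chart_index A) x (cx : chart_image c x) :=
  OpenDomain (@chart_image_open R n M A c) cx.

Lemma metric_posdefP c x : chart_image c x -> posdef (metric_mx g c x).
Proof. by move=> cx v; exact: metric_posdef. Qed.

Lemma chart_image_inv (c : chart_index A) x : chart_image c x -> chart_dom c (chart_inv c x).
Proof. by move=> [p cp <-]; rewrite chartK. Qed.

Lemma chart_invK (c : chart_index A) x : chart_image c x -> chart c (chart_inv c x) = x.
Proof. by move=> [p cp <-]; rewrite chartK. Qed.

Lemma overlap_open (c e : chart_index A) :
  open (chart c @` (chart_dom c `&` chart_dom e)).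
Proof.
rewrite openE => x [p [cp ep] px].
have cx : chart_image c x by exists p.
have pE : chart_inv c x = p by rewrite -px chartK.
have n1 : nbhs x (chart_image c).
  by apply: open_nbhs_nbhs; split=> //; exact: chart_image_open.
have n2 : nbhs x (chart_inv c @^-1` chart_dom e).
  apply: (chart_inv_continuous cx); rewrite pE.
  by apply: open_nbhs_nbhs; split=> //; exact: chart_dom_open.
apply: filterS (filterI n1 n2) => z [cz ez].
by exists (chart_inv c z); [split=> //; exact: chart_image_inv|exact: chart_invK].
Qed.

Definition chart_sqnorm lambda c x : R :=
  defect_sqnorm (metric_mx g c) (in_chart f c) lambda x.

Lemma chart_sqnorm_transition lambda c e p : chart_dom c p -> chart_dom e p ->
  chart_sqnorm lambda c (chart c p) = chart_sqnorm lambda e (chart e p).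
Proof.
move=> cp ep.
have Vx : (chart c @` (chart_dom c `&` chart_dom e)) (chart c p) by exists p.
have Ux : chart_image e (chart e p) by exists p.
pose V := OpenDomain (@overlap_open c e) Vx.
pose U := chart_domain Ux.
have VU : dom_set V `<=` chart_image c by move=> _ [q [cq _] <-]; exists q.
have F_dom x : dom_set V x -> dom_set U (transition c e x).
  by move=> [q [cq eq] <-]; rewrite /transition /= chartK //; exists q.
have unit (c' : chart_index A) x : chart_image c' x -> metric_mx g c' x \in unitmx.
  by move=> cx; exact: posdef_unitmx (metric_posdefP cx).
have fE x : dom_set V x -> in_chart f c x = in_chart f e (transition c e x).
  by move=> [q [cq eq] <-]; rewrite /in_chart /transition /= !chartK.
have := @defect_sqnorm_transition R n U V (metric_mx g c) (metric_mx g e)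
  (in_chart f c) (in_chart f e) (transition c e) (@transition_smooth R n M A c e) F_dom
  (fun i j => smooth_on_sub VU (@metric_smooth R n M A g c i j))
  (fun x Vx => metric_sym g (VU x Vx)) (fun x Vx => unit c x (VU x Vx))
  (smooth_on_sub VU (@f_smooth c)) (@metric_smooth R n M A g e)
  (fun x Ux => metric_sym g Ux) (unit e) (@f_smooth e) fE
  (fun x Vx => metric_transition g Vx) lambda (chart c p) Vx.
by rewrite /chart_sqnorm /transition /= chartK.
Qed.

End Charts.

Section GlobalMaximum.
Variables (R : realType) (n : nat) (M : topologicalType).
Variables (A : smooth_manifold R n M) (g : riemannian_metric A) (f : M -> R).
Variable lambda : R.
Hypothesis M_compact : compact [set: M].
Hypothesis f_smooth : smooth_function A f.
Hypothesis sec_pos : positive_sectional_curvature g.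
Hypothesis div_free : weighted_riem_div_free g f.
Hypothesis trace_eq : soliton_trace_equation g f lambda.

Let chart_at (p : M) : {c : chart_index A | chart_dom c p} := cid (chart_cover A p).

(** |S|^2 as a function on the manifold, by an arbitrary choice of chart at each point; [PhiE] frees
    it from the choice, so that compactness can be applied. *)
Let Phi (p : M) : R :=
  let c := sval (chart_at p) in chart_sqnorm g f lambda c (chart c p).

Let PhiE c p : chart_dom c p -> Phi p = chart_sqnorm g f lambda c (chart c p).
Proof.
by move=> cp; apply: chart_sqnorm_transition => //; exact: (svalP (chart_at p)).
Qed.

Let Phi_smooth c x (cx : chart_image c x) :
  smooth_on (chart_image c) (chart_sqnorm g f lambda c).
Proof.
exact: (@defect_sqnorm_smooth R n (chart_domain cx) (metric_mx g c) (in_chart f c)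
  lambda (@metric_smooth R n M A g c) (fun x cx => metric_posdefP g cx) (@f_smooth c)).
Qed.

Let Phi_continuous : continuous Phi.
Proof.
move=> p; have [c cp] := chart_at p.
have cx : chart_image c (chart c p) by exists p.
have near_c : nbhs p (chart_dom c).
  by apply: open_nbhs_nbhs; split=> //; exact: chart_dom_open.
have cont : {for p, continuous (chart_sqnorm g f lambda c \o chart c)}.
  apply: continuous_comp; first exact: chart_continuous.
  exact: smooth_on_continuous (Phi_smooth cx) cx.
rewrite /continuous_at (PhiE cp) => P /cont nP.
have nP' : nbhs p ((chart_sqnorm g f lambda c \o chart c) @^-1` P) by exact: nP.
by apply: filterS (filterI nP' near_c) => q /= [Pq cq]; rewrite /preimage /= (PhiE cq).
Qed.

(** The defect vanishes at a point where |S|^2 is maximal on the whole manifold. So the maximum is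
    zero, and the nonnegative |S|^2 vanishes at every point. *)
Lemma soliton_of_div_free : gradient_ricci_soliton g f lambda.
Proof.
move=> c x cx.
have defect0 : soliton_defect (metric_mx g c) (in_chart f c) lambda x = 0.
  have [p _ pmax] : exists2 p, p \in [set: M] & forall q, q \in [set: M] -> Phi q <= Phi p.
    (* The point under consideration shows that the manifold is nonempty. *)
    apply: compact_EVT_max => //; first by exists (chart_inv c x).
    exact: continuous_subspaceT Phi_continuous.
  have [e ep] := chart_at p.
  have ex : chart_image e (chart e p) by exists p.
  have p0 : soliton_defect (metric_mx g e) (in_chart f e) lambda (chart e p) = 0.
    apply: (@defect_at_max R n (chart_domain ex) (metric_mx g e) (in_chart f e)
      lambda (@metric_smooth R n M A g e) (fun x => @metric_sym _ _ _ _ g e x)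
      (fun x cx => metric_posdefP g cx) (@f_smooth e) (@div_free e)
      (@trace_eq e) (@sec_pos e) (chart e p) ex) => y ey.
    have := pmax (chart_inv e y) (in_setT _).
    rewrite (PhiE ep) (PhiE (chart_image_inv ey)) chart_invK //.
  apply: (@defect_sqnorm_eq0 R n (chart_domain cx) (metric_mx g c) (in_chart f c)
      lambda (@metric_smooth R n M A g c) (fun x => @metric_sym _ _ _ _ g c x)
      (fun x cx => metric_posdefP g cx) (@f_smooth c)) => //.
  apply/eqP; rewrite eq_le; apply/andP; split; last first.
    exact: (@defect_sqnorm_ge0 R n (chart_domain cx) (metric_mx g c) (in_chart f c)
      lambda (@metric_smooth R n M A g c) (fun x => @metric_sym _ _ _ _ g c x)
      (fun x cx => metric_posdefP g cx) (@f_smooth c)).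
  have := pmax (chart_inv c x) (in_setT _).
  rewrite (PhiE ep) (PhiE (chart_image_inv cx)) chart_invK //.
  by rewrite {2}/chart_sqnorm /defect_sqnorm p0 !mul0mx mxtrace0.
move=> i j; have /matrixP/(_ i j) := defect0.
by rewrite !mxE => /subr0_eq.
Qed.

End GlobalMaximum.

Theorem proposition2p7 (R : realType) (n : nat) (M : topologicalType)
    (A : smooth_manifold R n M) (g : riemannian_metric A) (f : M -> R)
    (n_ge3 : (3 <= n)%N)
    (M_compact : compact [set: M])
    (sec_pos : positive_sectional_curvature g)
    (f_smooth : smooth_function A f) :
  (weighted_riem_div_free g f /\
   exists lambda : R, soliton_trace_equation g f lambda)
  <->
  exists lambda : R, gradient_ricci_soliton g f lambda.
Proof.
split=> [[div_free [lambda trace_eq]]|[lambda sol]].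
  by exists lambda; exact: soliton_of_div_free.
have defect0 (c : chart_index A) x : chart_image c x ->
    soliton_defect (metric_mx g c) (in_chart f c) lambda x = 0.
  by move=> cx; apply/matrixP=> i j; rewrite !mxE sol // subrr.
split.
  move=> c x cx; exact: (@soliton_div_free R n (chart_domain cx) (metric_mx g c)
    (in_chart f c) lambda (@metric_smooth R n M A g c) (fun x => @metric_sym _ _ _ _ g c x)
    (fun x cx => metric_posdefP g cx) (@f_smooth c) (@defect0 c)).
exists lambda => c x cx; exact: (@soliton_trace R n (chart_domain cx) (metric_mx g c)
    (in_chart f c) lambda (fun x => @metric_sym _ _ _ _ g c x)
    (fun x cx => metric_posdefP g cx) x cx (defect0 c x cx)).
Qed.
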